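(* Let $N\ge1$ be an integer, $\alpha>-1$ real, $0<\xi<1$. Put $z=N+\alpha$, $z'=N$, and let $K_{++}(k,l)$, $k,l\in\mathbb Z_+$, be the ''$++$'' block of the hypergeometric kernel with parameters $z,z',\xi$. Let $M_N$ be the $N$th Meixner kernel with parameters $\alpha,\xi$. Then for all $k,l\in\mathbb Z_+$ $$K_{++}(k,l)=M_N(k+N,l+N).$$
   Context: $\mathbb Z_+=\{0,1,2,\dots\}$; $(a)_k=a(a+1)\cdots(a+k-1)$, $(a)_0=1$; $F(a,b;c;w)$ is the Gauss hypergeometric function ${}_2F_1$ (analytically continued in $w$ to $\mathbb C\setminus[1,\infty)$). ''$++$'' block of the hypergeometric kernel with parameters $z,z',\xi$: put $t=zz'$, $$\psi_+(u)=t^{1/2}\,\xi^{u+1/2}\,(1-\xi)^{z+z'}\,\frac{\Gamma(u+1+z)\Gamma(u+1+z')}{\Gamma(1+z)\Gamma(1+z')\Gamma(u+1)\Gamma(u+1)},$$ $$P_+(u)=\psi_+(u)^{1/2}F\!\left(-z,-z';u+1;\tfrac{\xi}{\xi-1}\right),\qquad Q_+(u)=\frac{t^{1/2}\xi^{1/2}\psi_+(u)^{1/2}}{1-\xi}\,\frac{F\!\left(1-z,1-z';u+2;\tfrac{\xi}{\xi-1}\right)}{u+1}$$ (positive square roots), and $$K_{++}(k,l)=\frac{P_+(k)Q_+(l)-Q_+(k)P_+(l)}{k-l},$$ where for $k=l$ the value is given by the L'Hospital rule, $K_{++}(k,k)=P_+'(k)Q_+(k)-Q_+'(k)P_+(k)$.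 Meixner kernel: the Meixner polynomials are $$\mathfrak M_n(k;\alpha+1,\xi)=F\!\left(-n,-k;\alpha+1;\tfrac{\xi-1}{\xi}\right),$$ polynomials in $k$ of degree $n$, orthogonal on $\mathbb Z_+$ with respect to the weight $f(k)=\frac{(\alpha+1)_k\xi^k}{k!}$, with $$h_n=\sum_{k=0}^\infty\mathfrak M_n(k;\alpha+1,\xi)^2f(k)=\frac{n!}{\xi^n(1-\xi)^{\alpha+1}(\alpha+1)_n}.$$ The $N$th Meixner kernel (the Christoffel–Darboux kernel transferred to $\ell^2(\mathbb Z_+)$ with counting measure) is $$M_N(k,l)=\sum_{n=0}^{N-1}\frac{\mathfrak M_n(k;\alpha+1,\xi)\,\mathfrak M_n(l;\alpha+1,\xi)}{h_n}\sqrt{f(k)f(l)},\qquad k,l\in\mathbb Z_+ .$$ *)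

(* Defs.v *)
From Stdlib Require Import Reals Factorial ClassicalEpsilon.
From Coquelicot Require Import Coquelicot.

Open Scope R_scope.

Fixpoint poch (a : R) (n : nat) : R :=
  match n with
  | O => 1
  | S m => poch a m * (a + INR m)
  end.

Fixpoint Cpoch (a : C) (n : nat) : C :=
  match n with
  | O => RtoC 1
  | S m => (Cpoch a m * (a + RtoC (INR m)))%C
  end.

(* Gauss's limit  n! n^x / (x (x+1) ... (x+n)),  valid for every real x that is
   not a pole of the Gamma function. *)
Definition Gamma (x : R) : R :=
  real (Lim_seq (fun n => INR (fact n) * Rpower (INR n) x / poch x (S n))).

Definition hyp_coef (a b c : C) (n : nat) : C :=
  (Cpoch a n * Cpoch b n / (Cpoch c n * RtoC (INR (fact n))))%C.

Definition C_analytic_at (f : C -> C) (w0 : C) : Prop :=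
  exists (a : nat -> C) (r : R), 0 < r /\
    forall w : C, Cmod (w - w0)%C < r ->
      @is_pseries C_AbsRing C_NormedModule a (w - w0)%C (f w).

(* The plane cut along the ray [1, +oo). *)
Definition cut_plane (w : C) : Prop := ~ (Im w = 0 /\ 1 <= Re w).

Definition is_hyp_continuation (a b c : C) (f : C -> C) : Prop :=
  (forall w : C, cut_plane w -> C_analytic_at f w) /\
  (forall w : C, Cmod w < 1 ->
     @is_pseries C_AbsRing C_NormedModule (hyp_coef a b c) w (f w)).

(* The cut plane is connected, so the continuation is unique there; the values
   on [1, +oo) are arbitrary and must not be used.  The lower parameter c must
   not be in {0, -1, -2, ...}. *)
Definition Chyp2F1 (a b c : C) : C -> C :=
  epsilon (inhabits (fun _ : C => RtoC 0)) (is_hyp_continuation a b c).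

(* For real a, b, c and real w < 1 the value of the continuation is real. *)
Definition hyp2F1 (a b c w : R) : R :=
  Re (Chyp2F1 (RtoC a) (RtoC b) (RtoC c) (RtoC w)).

Definition psi_plus (z z' xi u : R) : R :=
  sqrt (z * z') * Rpower xi (u + 1/2) * Rpower (1 - xi) (z + z') *
  (Gamma (u + 1 + z) * Gamma (u + 1 + z') /
   (Gamma (1 + z) * Gamma (1 + z') * Gamma (u + 1) * Gamma (u + 1))).

Definition P_plus (z z' xi u : R) : R :=
  sqrt (psi_plus z z' xi u) * hyp2F1 (- z) (- z') (u + 1) (xi / (xi - 1)).

Definition Q_plus (z z' xi u : R) : R :=
  sqrt (z * z') * sqrt xi * sqrt (psi_plus z z' xi u) / (1 - xi) *
  (hyp2F1 (1 - z) (1 - z') (u + 2) (xi / (xi - 1)) / (u + 1)).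

Definition K_plus_plus (z z' xi : R) (k l : nat) : R :=
  let P := P_plus z z' xi in
  let Q := Q_plus z z' xi in
  if Nat.eq_dec k l
  then Derive P (INR k) * Q (INR k) - Derive Q (INR k) * P (INR k)
  else (P (INR k) * Q (INR l) - Q (INR k) * P (INR l)) / (INR k - INR l).

(* The parameter beta stands for alpha + 1. *)
Definition meixner (n : nat) (x beta xi : R) : R :=
  hyp2F1 (- INR n) (- x) beta ((xi - 1) / xi).

Definition meixner_weight (alpha xi : R) (k : nat) : R :=
  poch (alpha + 1) k * xi ^ k / INR (fact k).

Definition meixner_norm (alpha xi : R) (n : nat) : R :=
  Series (fun k => meixner n (INR k) (alpha + 1) xi ^ 2 *
                   meixner_weight alpha xi k).

Definition meixner_kernel (alpha xi : R) (N k l : nat) : R :=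
  match N with
  | O => 0
  | S m =>
      sum_n (fun n =>
        meixner n (INR k) (alpha + 1) xi * meixner n (INR l) (alpha + 1) xi /
        meixner_norm alpha xi n *
        sqrt (meixner_weight alpha xi k * meixner_weight alpha xi l)) m
  end.

(* Main.v *)
(* Since z' = N is a natural number, both Gauss functions in P_+ and Q_+ terminate, and
   reversing the order of summation turns them into the Meixner polynomials M_N(u + N) and
   M_(N-1)(u + N), up to explicit factors. So K_++ is the Christoffel-Darboux form of the
   Meixner kernel. The Christoffel-Darboux formula follows from the three-term recurrence once
   the norms h_n are known. The symmetry M_n(k) = M_k(n) turns that recurrence into a difference
   equation in k, whose discrete Green formula gives orthogonality; the recurrence then gives
   h_(n+1) / h_n, and h_0 is the negative binomial series. On the diagonal one also needs that
   psi_+ is differentiable, which rests on the locally uniform convergence of the logarithm of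
   Gauss's product for Gamma and of its derivative. *)

Require Import Defs.
From Stdlib Require Import Reals.
From Coquelicot Require Import Coquelicot.
From Stdlib Require Import Factorial ClassicalEpsilon FunctionalExtensionality Lra Lia.
Open Scope R_scope.

(** * Terminating hypergeometric series *)

(** [hyp2F1] is the real part of a continuation picked by [epsilon]. Its argument [xi / (xi - 1)]
    leaves the open unit disk when xi >= 1/2, and [(xi - 1) / xi] leaves it when xi <= 1/2; there
    the Gauss series does not describe the picked function. Both arguments are negative, so it
    suffices to identify the pick with a polynomial along the real half-line. The diagonal values
    are derivatives in u. Hence the reversal, the recurrence in the degree and the
    Christoffel-Darboux formula are established at real arguments, while self-duality, the
    difference equation and orthogonality stay on integer points. The choice of parameters comes
    from the reversal: with lower parameter beta, a sum of degree N in x = u + N acquires the upper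
    parameter -(N + beta - 1). For beta = alpha + 1 this is -z, and u + N is the shift by N in the
    theorem. P_+ and Q_+ share the factor sqrt psi_+; what remains is a pair of rational functions
    of u, whose Wronskian carries the whole kernel up to one constant. *)

Notation is_Cpseries := (@is_pseries C_AbsRing C_NormedModule).

(** A power series is continuous at 0, so its constant coefficient is the limit of [g] from the
    right, which is 0. Dividing by h then gives the shifted series, whose sum still vanishes on the
    right. Vanishing on one side is what the supremum argument below can supply. *)
Lemma real_pseries_identity (g : R -> R) (r d : R) (b : nat -> R) :
  0 < d -> 0 < r ->
  (forall h, Rabs h < r -> is_pseries b h (g h)) ->
  (forall h, 0 < h < d -> g h = 0) ->
  forall n, b n = 0.
Proof.
  intros Hd Hr Hb Hg n; revert g b Hb Hg.
  assert (H0 : forall g b, (forall h, Rabs h < r -> is_pseries b h (g h)) ->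
     (forall h, 0 < h < d -> g h = 0) -> b 0%nat = 0).
  { intros g b Hb Hg.
    assert (Hc : continuity_pt (PSeries b) 0).
    { apply PSeries_continuity. rewrite Rabs_R0.
      apply Rbar_lt_le_trans with (Rabs (r/2)).
      - simpl. rewrite Rabs_pos_eq; lra.
      - apply Rbar_not_lt_le; intro Hlt.
        apply CV_disk_outside in Hlt. apply Hlt.
        apply (is_lim_seq_ext (fun n => scal (pow_n (r/2) n) (b n))).
        { intros m. rewrite pow_n_pow. apply Rmult_comm. }
        apply ex_series_lim_0. exists (g (r/2)). apply Hb. rewrite Rabs_pos_eq; lra. }
    rewrite <- (PSeries_0 b).
    apply continuity_pt_filterlim in Hc.
    destruct (Req_dec (PSeries b 0) 0) as [|Hne]; [assumption|exfalso].
    assert (He : 0 < Rabs (PSeries b 0)) by (apply Rabs_pos_lt; assumption).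
    pose proof (proj1 (filterlim_locally (T := R_UniformSpace) (U := R_UniformSpace) (F := locally 0)
      (PSeries b) (PSeries b 0)) Hc (mkposreal _ He)) as Hc'. clear Hc; rename Hc' into Hc.
    destruct Hc as [e Hc].
    set (h := Rmin (e/2) (Rmin (d/2) (r/2))).
    assert (Hh : 0 < h /\ h < e /\ h < d /\ h < r).
    { destruct e as [e He']; simpl in *. unfold h, Rmin. repeat destruct Rle_dec; lra. }
    specialize (Hc h). simpl in Hc. unfold ball in Hc; simpl in Hc.
    unfold AbsRing_ball, abs, minus, plus, opp in Hc; simpl in Hc.
    assert (Hz : PSeries b h = 0).
    { apply is_pseries_unique. rewrite <- (Hg h) by lra. apply Hb. rewrite Rabs_pos_eq; lra. }
    rewrite Hz in Hc.
    rewrite Rplus_0_l, Rabs_Ropp in Hc.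
    apply (Rlt_irrefl (Rabs (PSeries b 0))). apply Hc.
    rewrite Ropp_0, Rplus_0_r, Rabs_pos_eq; lra. }
  induction n as [|n IH]; intros g b Hb Hg.
  - exact (H0 g b Hb Hg).
  - assert (Hb0 := H0 g b Hb Hg).
    apply (IH (fun h => if Req_EM_T h 0 then b 1%nat else g h / h) (PS_decr_1 b)).
    + intros h Hh. destruct (Req_EM_T h 0) as [->|Hne].
      * apply (is_pseries_0 (PS_decr_1 b)).
      * replace (g h / h) with (scal (/h) (plus (g h) (opp (b 0%nat)))).
        2:{ unfold scal, plus, opp; simpl; unfold mult; simpl. rewrite Hb0. field; auto. }
        apply (is_pseries_decr_1 b h (/h)).
        -- unfold mult, one; simpl. field; auto.
        -- apply Hb; auto.
    + intros h Hh. destruct (Req_EM_T h 0); [lra|]. rewrite Hg; [field; auto|auto].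
Qed.

Lemma pow_n_RtoC (x : R) (n : nat) :
  pow_n (K := C_AbsRing) (RtoC x) n = RtoC (pow_n (K := R_AbsRing) x n).
Proof.
  induction n as [|n IH]; [reflexivity|].
  change (Cmult x (pow_n (K := C_AbsRing) (RtoC x) n) = RtoC (x * pow_n (K := R_AbsRing) x n)).
  now rewrite IH, RtoC_mult.
Qed.

Lemma is_Cpseries_real (a : nat -> C) (h : R) (l : C) :
  is_Cpseries a (RtoC h) l ->
  is_pseries (fun n => Re (a n)) h (Re l) /\ is_pseries (fun n => Im (a n)) h (Im l).
Proof.
  intros H.
  assert (Hs : forall n, sum_n (fun k => scal (pow_n (K := C_AbsRing) (RtoC h) k) (a k)) n =
     (sum_n (fun k => scal (pow_n (K := R_AbsRing) h k) (Re (a k))) n,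
      sum_n (fun k => scal (pow_n (K := R_AbsRing) h k) (Im (a k))) n)).
  { assert (E : forall k, scal (pow_n (K := C_AbsRing) (RtoC h) k) (a k) =
       (scal (pow_n (K := R_AbsRing) h k) (Re (a k)), scal (pow_n (K := R_AbsRing) h k) (Im (a k)))).
    { intros k. rewrite pow_n_RtoC. unfold scal; simpl. unfold mult; simpl. unfold Cmult; simpl.
      f_equal; unfold Re, Im; ring. }
    induction n as [|n IH].
    - rewrite !sum_O. apply E.
    - rewrite !sum_Sn, IH, E. reflexivity. }
  split.
  - intros P [e He].
    destruct (H (fun z => P (Re z))) as [n Hn].
    { exists e. intros z Hz. apply He. apply Hz. }
    exists n. intros m Hm. specialize (Hn m Hm). cbv beta in Hn. rewrite Hs in Hn. exact Hn.
  - intros P [e He].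
    destruct (H (fun z => P (Im z))) as [n Hn].
    { exists e. intros z Hz. apply He. apply Hz. }
    exists n. intros m Hm. specialize (Hn m Hm). cbv beta in Hn. rewrite Hs in Hn. exact Hn.
Qed.

Lemma C_scal_0_r (x : C) : scal (V := C_NormedModule) x (RtoC 0) = RtoC 0.
Proof. apply Cmult_0_r. Qed.

Lemma is_Cpseries_zero (a : nat -> C) (w l : C) :
  (forall n, a n = 0%C) -> is_Cpseries a w l -> l = 0%C.
Proof.
  intros Ha H.
  assert (H' : is_series (K := C_AbsRing) (V := C_NormedModule) (fun _ => zero) l).
  { revert H; apply is_series_ext. intros n. rewrite Ha. apply C_scal_0_r. }
  symmetry.
  apply (filterlim_locally_unique (F := eventually) (fun n => sum_n (fun _ : nat => zero : C_NormedModule) n)).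
  - apply filterlim_ext with (fun _ => zero : C_NormedModule).
    + intros n. induction n as [|n IH]; [rewrite sum_O|rewrite sum_Sn, <- IH, plus_zero_l]; reflexivity.
    + apply filterlim_const.
  - exact H'.
Qed.

(** Let M be the supremum of the lengths t for which [D] vanishes on [x0 - t, x0]. The expansion at
    x0 - M vanishes to the right of its centre, so all its coefficients are 0 and [D] vanishes a
    little further left; M can therefore only be the full length. *)
Lemma analytic_real_identity (D : C -> C) (x0 r : R) :
  0 < r ->
  (forall x, x <= x0 -> C_analytic_at D (RtoC x)) ->
  (forall x, x0 - r < x -> x < x0 + r -> D (RtoC x) = 0%C) ->
  forall x, x <= x0 -> D (RtoC x) = 0%C.
Proof.
  intros Hr Han Hz x Hx.
  set (E t := 0 <= t <= x0 - x /\ forall s, 0 <= s <= t -> D (RtoC (x0 - s)) = 0%C).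
  destruct (completeness E) as [M [HM1 HM2]].
  { exists (x0 - x). intros t [Ht _]. lra. }
  { exists 0. split; [lra|]. intros s Hs. apply Hz; lra. }
  assert (HM0 : 0 <= M).
  { apply HM1. split; [lra|]. intros s Hs. apply Hz; lra. }
  assert (HMx : M <= x0 - x).
  { apply HM2. intros t [Ht _]. lra. }
  (* Negative s reach to the right of x0. They keep an interval to the right of x0 - M available
     even if M = 0. *)
  assert (Hbelow : forall s, - r < s < M -> D (RtoC (x0 - s)) = 0%C).
  { intros s Hs. destruct (Rle_dec s 0).
    - apply Hz; lra.
    - destruct (classic (exists t, E t /\ s <= t)) as [[t [[Ht1 Ht2] Hst]]|Hn].
      + apply Ht2; lra.
      + exfalso. assert (M <= s); [|lra].
        apply HM2. intros t Ht. apply Rnot_lt_le. intros Hlt.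
        apply Hn. exists t. split; [exact Ht|lra]. }
  destruct (Han (x0 - M)) as [a [e [He Ha]]]; [lra|].
  assert (Hh : forall h, Rabs h < e -> is_Cpseries a (RtoC h) (D (RtoC (x0 - M + h)))).
  { intros h Hh. specialize (Ha (RtoC (x0 - M + h))).
    replace (RtoC (x0 - M + h) - RtoC (x0 - M))%C with (RtoC h) in Ha.
    2:{ rewrite <- RtoC_minus. f_equal. ring. }
    apply Ha. rewrite Cmod_R. exact Hh. }
  assert (Hv : forall h, 0 < h < r -> D (RtoC (x0 - M + h)) = 0%C).
  { intros h Hh'. replace (x0 - M + h) with (x0 - (M - h)) by ring. apply Hbelow. lra. }
  assert (Hall : forall n, a n = 0%C).
  { intros n.
    assert (HR : Re (a n) = 0).
    { apply (real_pseries_identity (fun h => Re (D (RtoC (x0 - M + h)))) e r (fun n => Re (a n))); auto.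
      - intros h Hh'. apply (is_Cpseries_real a h _ (Hh h Hh')).
      - intros h Hh'. rewrite Hv; auto. }
    assert (HI : Im (a n) = 0).
    { apply (real_pseries_identity (fun h => Im (D (RtoC (x0 - M + h)))) e r (fun n => Im (a n))); auto.
      - intros h Hh'. apply (is_Cpseries_real a h _ (Hh h Hh')).
      - intros h Hh'. rewrite Hv; auto. }
    destruct (a n) as [u v]; simpl in *; subst; reflexivity. }
  assert (Hnear : forall h, Rabs h < e -> D (RtoC (x0 - M + h)) = 0%C).
  { intros h Hh'. exact (is_Cpseries_zero a _ _ Hall (Hh h Hh')). }
  destruct (Rle_dec (x0 - x) M) as [Hle|Hgt].
  - replace x with (x0 - M + 0) by lra. apply Hnear. rewrite Rabs_R0; lra.
  - exfalso. set (t := Rmin (x0 - x) (M + e / 2)).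
    assert (Ht : M < t /\ t <= x0 - x /\ t <= M + e/2).
    { unfold t, Rmin; destruct Rle_dec; lra. }
    assert (E t).
    { split; [lra|]. intros s Hs. destruct (Rlt_dec s M).
      - apply Hbelow; lra.
      - replace (x0 - s) with (x0 - M + (M - s)) by ring. apply Hnear.
        rewrite Rabs_left1; lra. }
    assert (t <= M) by (apply HM1; auto). lra.
Qed.

(** * Polynomials as analytic functions *)

Lemma C_analytic_plus (f g : C -> C) (w0 : C) :
  C_analytic_at f w0 -> C_analytic_at g w0 -> C_analytic_at (fun w => f w + g w)%C w0.
Proof.
  intros [a [r [Hr Ha]]] [b [s [Hs Hb]]].
  exists (PS_plus a b), (Rmin r s). split.
  - apply Rmin_pos; auto.
  - intros w Hw. apply (is_pseries_plus (K := C_AbsRing) (V := C_NormedModule)).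
    + apply Ha. eapply Rlt_le_trans; [exact Hw|apply Rmin_l].
    + apply Hb. eapply Rlt_le_trans; [exact Hw|apply Rmin_r].
Qed.

Lemma C_analytic_scal (c : C) (f : C -> C) (w0 : C) :
  C_analytic_at f w0 -> C_analytic_at (fun w => c * f w)%C w0.
Proof.
  intros [a [r [Hr Ha]]]. exists (PS_scal (V := C_NormedModule) c a), r. split; auto.
  intros w Hw. apply (is_pseries_scal (K := C_AbsRing) (V := C_NormedModule)).
  - apply Cmult_comm.
  - auto.
Qed.

(** Writing w as (w - w0) + w0 splits the product into a shift of the series and a constant multiple
    of it, so monomials can be expanded at [w0] one factor at a time. *)
Lemma C_analytic_mult_id (f : C -> C) (w0 : C) :
  C_analytic_at f w0 -> C_analytic_at (fun w => w * f w)%C w0.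
Proof.
  intros Hf. destruct (C_analytic_scal w0 f w0 Hf) as [b [s [Hs Hb]]].
  destruct Hf as [a [r [Hr Ha]]].
  exists (PS_plus (PS_incr_1 (V := C_NormedModule) a) b), (Rmin r s). split.
  - apply Rmin_pos; auto.
  - intros w Hw.
    replace (w * f w)%C with (plus (scal (w - w0)%C (f w : C_NormedModule)) (w0 * f w)%C).
    2:{ change (((w - w0) * f w + w0 * f w) = w * f w)%C. ring. }
    apply (is_pseries_plus (K := C_AbsRing) (V := C_NormedModule)).
    + apply (is_pseries_incr_1 (K := C_AbsRing) (V := C_NormedModule)).
      apply Ha. eapply Rlt_le_trans; [exact Hw|apply Rmin_l].
    + apply Hb. eapply Rlt_le_trans; [exact Hw|apply Rmin_r].
Qed.

Lemma is_series_finite (K : AbsRing) (V : NormedModule K) (u : nat -> V) (n : nat) :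
  (forall k, (n < k)%nat -> u k = zero) -> is_series u (sum_n u n).
Proof.
  intros Hu. unfold is_series. apply filterlim_ext_loc with (fun _ => sum_n u n).
  - exists n. intros m Hm. induction Hm as [|m Hm IH]; [reflexivity|].
    rewrite sum_Sn, <- IH, Hu by lia. now rewrite plus_zero_r.
  - apply filterlim_const.
Qed.

Lemma C_analytic_const (c w0 : C) : C_analytic_at (fun _ => c) w0.
Proof.
  exists (fun n => match n with O => c | S _ => RtoC 0 end), 1. split; [lra|].
  intros w _.
  pose proof (is_series_finite C_AbsRing C_NormedModule (fun k =>
    scal (pow_n (K := C_AbsRing) (w - w0)%C k) (match k with O => c | S _ => RtoC 0 end)) 0) as H.
  rewrite sum_O in H. simpl pow_n in H at 2. rewrite (scal_one (V := C_NormedModule)) in H.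
  apply H. intros [|k] Hk; [lia|]. apply C_scal_0_r.
Qed.

Definition Cpolynomial (a : nat -> C) (n : nat) (w : C) : C :=
  sum_n (fun k => scal (pow_n (K := C_AbsRing) w k) (a k : C_NormedModule)) n.

Lemma C_analytic_polynomial (a : nat -> C) (n : nat) (w0 : C) :
  C_analytic_at (Cpolynomial a n) w0.
Proof.
  assert (Hmono : forall c k,
    C_analytic_at (fun w => scal (pow_n (K := C_AbsRing) w k) (c : C_NormedModule)) w0).
  { intros c k. induction k as [|k IH].
    - destruct (C_analytic_const c w0) as [b [r [Hr Hb]]]. exists b, r; split; auto.
      intros w Hw. simpl. rewrite (scal_one (V := C_NormedModule)). now apply Hb.
    - destruct (C_analytic_mult_id _ w0 IH) as [b [r [Hr Hb]]]. exists b, r; split; auto.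
      intros w Hw. simpl. rewrite <- (scal_assoc (V := C_NormedModule)). now apply Hb. }
  induction n as [|n IH].
  - destruct (Hmono (a 0%nat) 0%nat) as [b [r [Hr Hb]]]. exists b, r; split; auto.
    intros w Hw. unfold Cpolynomial. rewrite sum_O. now apply Hb.
  - destruct (C_analytic_plus _ _ w0 IH (Hmono (a (S n)) (S n))) as [b [r [Hr Hb]]].
    exists b, r; split; auto. intros w Hw. unfold Cpolynomial. rewrite sum_Sn. now apply Hb.
Qed.

Lemma Cpoch_RtoC (a : R) (n : nat) : Cpoch (RtoC a) n = RtoC (poch a n).
Proof.
  induction n as [|n IH]; [reflexivity|]. simpl. now rewrite IH, RtoC_mult, RtoC_plus.
Qed.

Lemma poch_pos (a : R) (n : nat) : 0 < a -> 0 < poch a n.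
Proof.
  intros Ha. induction n as [|n IH]; simpl; [lra|].
  apply Rmult_lt_0_compat; [auto|]. pose proof (pos_INR n). lra.
Qed.

Lemma poch_opp_INR (n k : nat) : (n < k)%nat -> poch (- INR n) k = 0.
Proof.
  intros H. induction H as [|k H IH]; simpl.
  - ring.
  - rewrite IH; ring.
Qed.

Definition hyp_sum (a b c w : R) (J : nat) : R :=
  sum_n (fun j => poch a j * poch b j / (poch c j * INR (fact j)) * w ^ j) J.

Lemma hyp_sum_sym (a b c w : R) (J : nat) : hyp_sum a b c w J = hyp_sum b a c w J.
Proof. apply sum_n_ext. intros j. now rewrite (Rmult_comm (poch a j)). Qed.

(* The polynomial is one continuation; the identity theorem along the real axis
   shows that the one picked by [epsilon] takes the same real values. *)
Lemma hyp2F1_terminating (n J : nat) (b c w : R) :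
  (n <= J)%nat -> 0 < c -> w < 1 ->
  hyp2F1 (- INR n) b c w = hyp_sum (- INR n) b c w J.
Proof.
  intros HnJ Hc Hw.
  set (h := hyp_coef (RtoC (- INR n)) (RtoC b) (RtoC c)).
  assert (Hh : forall k, h k = RtoC (poch (- INR n) k * poch b k / (poch c k * INR (fact k)))).
  { intros k. unfold h, hyp_coef. rewrite !Cpoch_RtoC.
    assert (poch c k * INR (fact k) <> 0).
    { apply Rmult_integral_contrapositive_currified;
        [apply Rgt_not_eq, poch_pos; auto|apply INR_fact_neq_0]. }
    rewrite RtoC_div by auto. now rewrite !RtoC_mult. }
  assert (Hh0 : forall k, (J < k)%nat -> h k = 0%C).
  { intros k Hk. rewrite Hh, poch_opp_INR by lia. f_equal. unfold Rdiv; ring. }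
  assert (Hser : forall w', is_Cpseries h w' (Cpolynomial h J w')).
  { intros w'. apply is_series_finite. intros k Hk. rewrite Hh0 by auto.
    apply C_scal_0_r. }
  assert (Hex : exists f, is_hyp_continuation (RtoC (- INR n)) (RtoC b) (RtoC c) f).
  { exists (Cpolynomial h J). split.
    - intros w' _. apply C_analytic_polynomial.
    - intros w' _. apply Hser. }
  pose proof (epsilon_spec (inhabits (fun _ : C => RtoC 0)) _ Hex) as [Han Hdisk].
  fold (Chyp2F1 (RtoC (- INR n)) (RtoC b) (RtoC c)) in Han, Hdisk.
  set (f := Chyp2F1 (RtoC (- INR n)) (RtoC b) (RtoC c)) in *.
  set (D w' := (f w' + - (1) * Cpolynomial h J w')%C).
  assert (Hin : forall w', Cmod w' < 1 -> D w' = 0%C).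
  { intros w' Hw'. apply (is_Cpseries_zero (fun _ => 0%C) w'); [reflexivity|].
    apply (is_series_ext (K := C_AbsRing) (V := C_NormedModule) (fun k =>
       plus (scal (pow_n (K := C_AbsRing) w' k) (h k : C_NormedModule)) (opp (scal (pow_n (K := C_AbsRing) w' k) (h k : C_NormedModule))))).
    - intros k. rewrite C_scal_0_r. apply Cplus_opp_r.
    - replace (D w') with (plus (f w' : C_NormedModule) (opp (Cpolynomial h J w' : C_NormedModule))).
      2:{ unfold D. change (f w' + - Cpolynomial h J w' = f w' + - (1) * Cpolynomial h J w')%C. ring. }
      apply is_series_plus; [now apply Hdisk|]. apply is_series_opp. apply Hser. }
  assert (HDw : D (RtoC w) = 0%C).
  (* A positive w < 1 already lies in the unit disk. From 0 leftwards the identity theorem applies,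
     started at 0 with radius 1. *)
  { destruct (Rle_dec w 0) as [Hw0|Hw0].
    - apply (analytic_real_identity D 0 1); auto; try lra.
      + intros x Hx. apply C_analytic_plus.
        * apply Han. intros [_ H]. simpl in H. lra.
        * apply C_analytic_scal, C_analytic_polynomial.
      + intros x H1 H2. apply Hin. rewrite Cmod_R. apply Rabs_def1; lra.
    - apply Hin. rewrite Cmod_R. apply Rabs_def1; lra. }
  assert (Hf : f (RtoC w) = Cpolynomial h J (RtoC w)).
  { replace (f (RtoC w)) with (D (RtoC w) + Cpolynomial h J (RtoC w))%C by (unfold D; ring).
    rewrite HDw. ring. }
  unfold hyp2F1. fold f. rewrite Hf.
  unfold Cpolynomial, hyp_sum.
  clear - Hh.
  assert (E : forall k, Re (scal (pow_n (K := C_AbsRing) (RtoC w) k) (h k : C_NormedModule)) =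
     poch (- INR n) k * poch b k / (poch c k * INR (fact k)) * w ^ k).
  { intros k. rewrite pow_n_RtoC, pow_n_pow, Hh.
    change (Re (RtoC (w ^ k) * RtoC (poch (- INR n) k * poch b k / (poch c k * INR (fact k))))%C
       = poch (- INR n) k * poch b k / (poch c k * INR (fact k)) * w ^ k).
    rewrite <- RtoC_mult. unfold Re, RtoC; simpl fst. ring. }
  induction J as [|J IH].
  - rewrite !sum_O. apply E.
  - rewrite !sum_Sn, <- IH, <- E. reflexivity.
Qed.

(** * The Gamma function on the positive reals *)

Lemma ln_le_minus_1 (y : R) : 0 < y -> ln y <= y - 1.
Proof.
  intros Hy. pose proof (exp_ineq1_le (ln y)). rewrite exp_ln in H; lra.
Qed.

(** Both bounds are ln y <= y - 1, taken at y = a/b and at y = b/a. *)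
Lemma ln_diff_bounds (a b : R) : 0 < a -> 0 < b ->
  (b - a) / b <= ln b - ln a <= (b - a) / a.
Proof.
  intros Ha Hb. split.
  - pose proof (ln_le_minus_1 (a / b)) as H. unfold Rdiv in H.
    rewrite ln_mult, ln_Rinv in H by (try apply Rinv_0_lt_compat; auto).
    assert (0 < a * / b) by (apply Rmult_lt_0_compat; [|apply Rinv_0_lt_compat]; auto).
    specialize (H H0). replace ((b - a) / b) with (1 - a * / b) by (field; lra). lra.
  - pose proof (ln_le_minus_1 (b / a)) as H. unfold Rdiv in H.
    rewrite ln_mult, ln_Rinv in H by (try apply Rinv_0_lt_compat; auto).
    assert (0 < b * / a) by (apply Rmult_lt_0_compat; [|apply Rinv_0_lt_compat]; auto).
    specialize (H H0). replace ((b - a) / a) with (b * / a - 1) by (field; lra). lra.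
Qed.

(** The majorant is c/(j+1) - c/(j+2), so the tail after index n is at most c/(n+2), uniformly in
    x. *)
Lemma CVU_dom_sum_telescoping_bound (u : nat -> R -> R) (D : R -> Prop) (c : R) :
  (forall j x, D x -> 0 <= u j x <= c / ((INR j + 1) * (INR j + 2))) ->
  CVU_dom (fun n x => sum_n (fun j => u j x) n) D.
Proof.
  intros Hu.
  assert (Htail : forall x n p, D x ->
    0 <= sum_n (fun j => u j x) (n + p) - sum_n (fun j => u j x) n
      <= c / (INR n + 2) - c / (INR (n + p) + 2)).
  { intros x n p Hx. induction p as [|p IH].
    - rewrite Nat.add_0_r. lra.
    - rewrite Nat.add_succ_r, sum_Sn. unfold plus; simpl.
      pose proof (Hu (S (n + p)) x Hx) as H.
      change (match (n + p)%nat with 0%nat => 1 | S _ => INR (n + p) + 1 end) with (INR (S (n + p))).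
      rewrite S_INR in *. pose proof (pos_INR (n + p)).
      replace (c / ((INR (n + p) + 1 + 1) * (INR (n + p) + 1 + 2)))
        with (c / (INR (n + p) + 2) - c / (INR (n + p) + 1 + 2)) in H by (field; lra).
      lra. }
  apply CVU_dom_cauchy. intros eps.
  (* That c is nonnegative follows only from a point of [D], which is not at hand yet; hence the
     absolute value. *)
  destruct (nfloor_ex (Rabs c / eps)) as [n0 [_ Hn0]].
  { apply Rmult_le_pos; [apply Rabs_pos|left; apply Rinv_0_lt_compat, cond_pos]. }
  assert (He : forall n, (n0 <= n)%nat -> Rabs c / (INR n + 2) < eps).
  { intros n Hn. apply le_INR in Hn. pose proof (pos_INR n). pose proof (cond_pos eps) as Hp.
    apply Rmult_lt_reg_r with (INR n + 2); [lra|].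
    replace (Rabs c / (INR n + 2) * (INR n + 2)) with (Rabs c / eps * eps) by (field; lra).
    rewrite (Rmult_comm eps). apply Rmult_lt_compat_r; lra. }
  assert (Hle : forall n m x, D x -> (n0 <= n)%nat -> (n <= m)%nat ->
    Rabs (sum_n (fun j => u j x) n - sum_n (fun j => u j x) m) < eps).
  { intros n m x Hx Hn Hm. replace m with (n + (m - n))%nat by lia.
    pose proof (Htail x n (m - n)%nat Hx). specialize (He n Hn).
    rewrite Rabs_minus_sym, Rabs_pos_eq by lra.
    assert (0 <= c).
    { pose proof (Hu 0%nat x Hx) as H1. simpl in H1.
      replace (c / ((0 + 1) * (0 + 2))) with (c / 2) in H1 by field. lra. }
    rewrite Rabs_pos_eq in He by auto.
    assert (0 <= c / (INR (n + (m - n)) + 2)).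
    { apply Rmult_le_pos; auto. left; apply Rinv_0_lt_compat. pose proof (pos_INR (n + (m - n))). lra. }
    lra. }
  exists n0. intros n m x Hx Hn Hm. destruct (Nat.le_ge_cases n m).
  - now apply Hle.
  - rewrite Rabs_minus_sym. now apply Hle.
Qed.

(* Logarithm of the ratio of the terms of index [j + 2] and [j + 1] in Gauss's limit. *)
Definition lnGamma_incr (j : nat) (x : R) : R :=
  x * (ln (INR j + 2) - ln (INR j + 1)) - (ln (x + INR j + 2) - ln (INR j + 2)).

Definition lnGamma_incr' (j : nat) (x : R) : R :=
  (ln (INR j + 2) - ln (INR j + 1)) - / (x + INR j + 2).

Lemma lnGamma_incr_bound (B : R) (j : nat) (x : R) : 0 < x < B ->
  0 <= lnGamma_incr j x <= B * (B + 1) / ((INR j + 1) * (INR j + 2)).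
Proof.
  intros Hx. pose proof (pos_INR j) as Hj. set (t := INR j) in *.
  destruct (ln_diff_bounds (t + 1) (t + 2)) as [H1 H2]; try lra.
  destruct (ln_diff_bounds (t + 2) (x + t + 2)) as [H3 H4]; try lra.
  unfold lnGamma_incr. fold t.
  replace (t + 2 - (t + 1)) with 1 in * by ring.
  replace (x + t + 2 - (t + 2)) with x in * by ring.
  apply (Rmult_le_compat_l x) in H1; [|lra]. apply (Rmult_le_compat_l x) in H2; [|lra].
  split.
  - unfold Rdiv in *. lra.
  - apply Rle_trans with (x * (1 / (t + 1)) - x / (x + t + 2)); [lra|].
    replace (x * (1 / (t + 1)) - x / (x + t + 2)) with
      (x * (x + 1) / ((t + 1) * (x + t + 2))) by (field; lra).
    apply Rmult_le_compat.
    + nra.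
    + left; apply Rinv_0_lt_compat; nra.
    + nra.
    + apply Rinv_le_contravar; nra.
Qed.

Lemma lnGamma_incr'_bound (B : R) (j : nat) (x : R) : 0 < x < B ->
  0 <= lnGamma_incr' j x <= (B + 1) / ((INR j + 1) * (INR j + 2)).
Proof.
  intros Hx. pose proof (pos_INR j) as Hj. set (t := INR j) in *.
  destruct (ln_diff_bounds (t + 1) (t + 2)) as [H1 H2]; try lra.
  unfold lnGamma_incr'. fold t.
  replace (t + 2 - (t + 1)) with 1 in * by ring.
  split.
  - assert (/ (x + t + 2) <= / (t + 2)) by (apply Rinv_le_contravar; lra). lra.
  - apply Rle_trans with (1 / (t + 1) - / (x + t + 2)); [lra|].
    replace (1 / (t + 1) - / (x + t + 2)) with
      ((x + 1) / ((t + 1) * (x + t + 2))) by (field; lra).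
    apply Rmult_le_compat.
    + lra.
    + left; apply Rinv_0_lt_compat; nra.
    + lra.
    + apply Rinv_le_contravar; nra.
Qed.

Lemma is_derive_lnGamma_incr (j : nat) (x : R) : 0 < x ->
  is_derive (lnGamma_incr j) x (lnGamma_incr' j x).
Proof.
  intros Hx. pose proof (pos_INR j). unfold lnGamma_incr, lnGamma_incr'.
  auto_derive; [lra|]. field. lra.
Qed.

Lemma is_derive_sum_lnGamma_incr (n : nat) (x : R) : 0 < x ->
  is_derive (fun y => sum_n (fun j => lnGamma_incr j y) n) x
    (sum_n (fun j => lnGamma_incr' j x) n).
Proof.
  intros Hx. apply (is_derive_sum_n lnGamma_incr n x (fun j => lnGamma_incr' j x)).
  intros k _. now apply is_derive_lnGamma_incr.
Qed.

Definition lnGamma_sum (x : R) : R :=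
  real (Lim_seq (fun n => sum_n (fun j => lnGamma_incr j x) n)).

(** The series is differentiated term by term on (0, x + 1). The interval is bounded because the two
    majorants grow with its right end [B]. *)
Lemma ex_derive_lnGamma_sum (x : R) : 0 < x -> ex_derive lnGamma_sum x.
Proof.
  intros Hx. set (B := x + 1).
  exists (real (Lim_seq (fun n => Derive (fun y => sum_n (fun j => lnGamma_incr j y) n) x))).
  assert (HD : forall n y, 0 < y < B ->
     Derive (fun y => sum_n (fun j => lnGamma_incr j y) n) y = sum_n (fun j => lnGamma_incr' j y) n).
  { intros n y Hy. apply is_derive_unique, is_derive_sum_lnGamma_incr. lra. }
  apply (CVU_Derive (fun n y => sum_n (fun j => lnGamma_incr j y) n) (fun y => 0 < y < B)).
  - apply open_and; [apply open_gt|apply open_lt].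
  - intros a b c Ha Hb Hc. lra.
  - apply (CVU_dom_sum_telescoping_bound _ _ (B * (B + 1))).
    intros j y Hy. now apply lnGamma_incr_bound.
  - intros n y Hy. eexists. apply is_derive_sum_lnGamma_incr. lra.
  - intros n y Hy.
    apply continuity_pt_ext_loc with (fun y => sum_n (fun j => lnGamma_incr' j y) n).
    + assert (Ho : open (fun y => 0 < y < B)) by (apply open_and; [apply open_gt|apply open_lt]).
      apply filter_imp with (2 := Ho y Hy). intros s Hs. symmetry. now apply HD.
    + apply continuity_pt_filterlim.
      apply (continuous_ext (fun y => sum_n_m (fun j => lnGamma_incr' j y) 0 n)); [reflexivity|].
      clear HD. apply (ex_derive_continuous (fun y => sum_n (fun j => lnGamma_incr' j y) n)).
      apply (ex_derive_sum_n lnGamma_incr'). intros k _. unfold lnGamma_incr'. pose proof (pos_INR k).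
      auto_derive. lra.
  - intros eps.
    destruct (CVU_dom_sum_telescoping_bound lnGamma_incr' (fun y => 0 < y < B) (B + 1)
      (fun j y Hy => lnGamma_incr'_bound B j y Hy) eps) as [n0 Hn0].
    exists n0. intros n Hn y Hy. rewrite HD by auto.
    rewrite (Lim_seq_ext _ _ (fun n => HD n y Hy)). now apply Hn0.
  - unfold B; lra.
Qed.

Lemma is_lim_lnGamma_sum (x : R) : 0 < x ->
  is_lim_seq (fun n => sum_n (fun j => lnGamma_incr j x) n) (lnGamma_sum x).
Proof.
  intros Hx.
  pose proof (CVU_dom_sum_telescoping_bound lnGamma_incr (fun y => 0 < y < x + 1) ((x + 1) * (x + 1 + 1))
     (fun j y Hy => lnGamma_incr_bound (x + 1) j y Hy)) as H.
  apply CVU_CVS_dom in H. specialize (H x). simpl in H.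
  apply ex_finite_lim_seq_correct in H; [|lra]. destruct H as [H1 H2].
  apply Lim_seq_correct in H1. unfold lnGamma_sum. rewrite H2. exact H1.
Qed.

Definition gauss_seq (x : R) (n : nat) : R :=
  INR (fact n) * Rpower (INR n) x / poch x (S n).

(** The product telescopes from index 1, not 0, since the power in the term of index 0 has base
    [INR 0], outside the domain of the logarithm. *)
Lemma gauss_seq_exp (x : R) (n : nat) : 0 < x ->
  gauss_seq x (S (S n)) = gauss_seq x 1 * exp (sum_n (fun j => lnGamma_incr j x) (n)) .
Proof.
  intros Hx.
  assert (Hstep : forall m, gauss_seq x (S (S m)) = gauss_seq x (S m) * exp (lnGamma_incr m x)).
  { intros m. unfold gauss_seq.
    change (poch x (S (S (S m)))) with (poch x (S (S m)) * (x + INR (S (S m)))).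
    pose proof (poch_pos x (S (S m)) Hx).
    change (fact (S (S m))) with (S (S m) * fact (S m))%nat. rewrite mult_INR.
    unfold Rpower, lnGamma_incr. pose proof (pos_INR m). rewrite !(S_INR (S m)), !(S_INR m).
    replace (INR m + 1 + 1) with (INR m + 2) by ring.
    replace (x * (ln (INR m + 2) - ln (INR m + 1)) - (ln (x + INR m + 2) - ln (INR m + 2)))
      with (x * ln (INR m + 2) + - (x * ln (INR m + 1)) + - ln (x + INR m + 2) + ln (INR m + 2)) by ring.
    rewrite !exp_plus, !exp_Ropp, !exp_ln by lra.
    pose proof (exp_pos (x * ln (INR m + 1))).
    rewrite <- Rplus_assoc. field. repeat split; lra. }
  induction n as [|n IH].
  - rewrite sum_O. apply Hstep.
  - rewrite sum_Sn, Hstep, IH. unfold plus; simpl. rewrite exp_plus. ring.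
Qed.

Lemma is_lim_gauss_seq_exp (x : R) : 0 < x ->
  is_lim_seq (gauss_seq x) (gauss_seq x 1 * exp (lnGamma_sum x)).
Proof.
  intros Hx. apply is_lim_seq_incr_1, is_lim_seq_incr_1.
  apply is_lim_seq_ext with (fun n => gauss_seq x 1 * exp (sum_n (fun j => lnGamma_incr j x) n)).
  - intros n. symmetry. now apply gauss_seq_exp.
  - apply (is_lim_seq_scal_l _ _ (exp (lnGamma_sum x))).
    apply (is_lim_seq_continuous exp).
    + apply derivable_continuous_pt, derivable_pt_exp.
    + now apply is_lim_lnGamma_sum.
Qed.

Lemma Gamma_exp (x : R) : 0 < x -> Gamma x = gauss_seq x 1 * exp (lnGamma_sum x).
Proof.
  intros Hx. pose proof (is_lim_seq_unique _ _ (is_lim_gauss_seq_exp x Hx)) as H.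
  unfold Gamma. unfold gauss_seq in H at 1. now rewrite H.
Qed.

Lemma is_lim_gauss_seq (x : R) : 0 < x -> is_lim_seq (gauss_seq x) (Gamma x).
Proof. intros Hx. rewrite Gamma_exp by auto. now apply is_lim_gauss_seq_exp. Qed.

Lemma gauss_seq_1 (x : R) : 0 < x -> gauss_seq x 1 = / (x * (x + 1)).
Proof.
  intros Hx. unfold gauss_seq, Rpower. simpl. rewrite ln_1, Rmult_0_r, exp_0. field. lra.
Qed.

Lemma Gamma_pos (x : R) : 0 < x -> 0 < Gamma x.
Proof.
  intros Hx. rewrite Gamma_exp, gauss_seq_1 by auto. apply Rmult_lt_0_compat; [|apply exp_pos].
  apply Rinv_0_lt_compat. nra.
Qed.

Lemma ex_derive_Gamma (x : R) : 0 < x -> ex_derive Gamma x.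
Proof.
  intros Hx.
  apply ex_derive_ext_loc with (fun y => / (y * (y + 1)) * exp (lnGamma_sum y)).
  - apply filter_imp with (fun y => 0 < y); [|apply (open_gt 0 x Hx)].
    intros y Hy. now rewrite Gamma_exp, gauss_seq_1.
  - apply (ex_derive_mult (fun y => / (y * (y + 1))) (fun y => exp (lnGamma_sum y))).
    + auto_derive. nra.
    + apply (ex_derive_comp exp lnGamma_sum).
      * exists (exp (lnGamma_sum x)). apply is_derive_Reals. apply derivable_pt_lim_exp.
      * now apply ex_derive_lnGamma_sum.
Qed.

Lemma poch_shift (x : R) (n : nat) : x * poch (x + 1) n = poch x (S n).
Proof.
  induction n as [|n IH]; [simpl; ring|].
  change (x * (poch (x + 1) n * (x + 1 + INR n)) = poch x (S n) * (x + INR (S n))).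
  rewrite <- IH, S_INR. ring.
Qed.

Lemma is_lim_seq_INR_ratio (a c : R) : 0 < c ->
  is_lim_seq (fun n => (INR n + a) / (INR n + c)) 1.
Proof.
  intros Hc. apply is_lim_seq_ext with (fun n => 1 + (a - c) * / (INR n + c)).
  - intros n. pose proof (pos_INR n). field. lra.
  - replace (Finite 1) with (Finite (1 + (a - c) * 0)) by (f_equal; ring).
    apply is_lim_seq_plus'; [apply is_lim_seq_const|].
    apply (is_lim_seq_scal_l _ (a - c) 0).
    replace (Finite 0) with (Rbar_inv p_infty) by reflexivity.
    apply is_lim_seq_inv; [|discriminate].
    apply is_lim_seq_plus with p_infty c; [apply is_lim_seq_INR|apply is_lim_seq_const|reflexivity].
Qed.

(** For n >= 1 the Gauss terms at x + 1 and at x differ by the factor x n / (n + x + 1), which tends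
    to x. *)
Lemma Gamma_succ (x : R) : 0 < x -> Gamma (x + 1) = x * Gamma x.
Proof.
  intros Hx.
  assert (H1 : is_lim_seq (fun n => x * gauss_seq x n * ((INR n + 0) / (INR n + (x + 1)))) (x * Gamma x * 1)).
  { apply is_lim_seq_mult'.
    - apply (is_lim_seq_scal_l (gauss_seq x) x (Gamma x)). now apply is_lim_gauss_seq.
    - apply is_lim_seq_INR_ratio. lra. }
  assert (H2 : is_lim_seq (fun n => x * gauss_seq x n * ((INR n + 0) / (INR n + (x + 1)))) (Gamma (x + 1))).
  { apply is_lim_seq_ext_loc with (gauss_seq (x + 1)); [|apply is_lim_gauss_seq; lra].
    exists 1%nat. intros n Hn. unfold gauss_seq. apply le_INR in Hn. simpl in Hn.
    assert (E : poch (x + 1) (S n) = poch x (S n) * (INR n + (x + 1)) / x).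
    { apply Rmult_eq_reg_l with x; [|lra]. rewrite poch_shift.
      change (poch x (S (S n))) with (poch x (S n) * (x + INR (S n))). rewrite S_INR. field. lra. }
    rewrite E, Rpower_plus, Rpower_1 by lra.
    pose proof (poch_pos x (S n) Hx). field. lra. }
  apply is_lim_seq_unique in H1. apply is_lim_seq_unique in H2.
  rewrite H1 in H2. injection H2. lra.
Qed.

Lemma poch_1 (n : nat) : poch 1 n = INR (fact n).
Proof.
  induction n as [|n IH]; [reflexivity|].
  change (poch 1 n * (1 + INR n) = INR (S n * fact n)). rewrite IH, mult_INR, S_INR. ring.
Qed.

Lemma Gamma_1 : Gamma 1 = 1.
Proof.
  assert (H : is_lim_seq (gauss_seq 1) 1).
  { apply is_lim_seq_ext_loc with (fun n => (INR n + 0) / (INR n + 1)); [|apply is_lim_seq_INR_ratio; lra].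
    exists 1%nat. intros n Hn. unfold gauss_seq. apply le_INR in Hn. simpl in Hn.
    rewrite poch_1, Rpower_1 by lra. change (fact (S n)) with (S n * fact n)%nat.
    rewrite mult_INR, S_INR. pose proof (INR_fact_lt_0 n). field. lra. }
  apply is_lim_seq_unique in H. assert (H' := is_lim_seq_unique _ _ (is_lim_gauss_seq 1 Rlt_0_1)).
  rewrite H in H'. now injection H'.
Qed.

Lemma Gamma_plus_INR (x : R) (n : nat) : 0 < x -> Gamma (x + INR n) = poch x n * Gamma x.
Proof.
  intros Hx. induction n as [|n IH].
  - simpl. rewrite Rplus_0_r; ring.
  - rewrite S_INR, <- Rplus_assoc, Gamma_succ, IH.
    + simpl. ring.
    + pose proof (pos_INR n). lra.
Qed.

(** * Meixner polynomials *)

Lemma sum_n_Sn_R (u : nat -> R) (n : nat) : sum_n u (S n) = sum_n u n + u (S n).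
Proof. exact (sum_Sn u n). Qed.

Lemma hyp_sum_0 (a b c w : R) : hyp_sum a b c w 0 = 1.
Proof. unfold hyp_sum. rewrite sum_O. simpl. field. Qed.

Lemma hyp_sum_S (a b c w : R) (J : nat) :
  hyp_sum a b c w (S J) = hyp_sum a b c w J +
    poch a (S J) * poch b (S J) / (poch c (S J) * INR (fact (S J))) * w ^ (S J).
Proof. unfold hyp_sum. now rewrite sum_Sn. Qed.

(** The two coefficient sequences are equal as functions, so [epsilon] receives the same predicate
    on both sides and makes the same choice. *)
Lemma hyp2F1_sym (a b c w : R) : hyp2F1 a b c w = hyp2F1 b a c w.
Proof.
  unfold hyp2F1, Chyp2F1, is_hyp_continuation.
  replace (hyp_coef (RtoC a) (RtoC b) (RtoC c)) with (hyp_coef (RtoC b) (RtoC a) (RtoC c)); [reflexivity|].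
  apply functional_extensionality. intros n. unfold hyp_coef. now rewrite (Cmult_comm (Cpoch a n)).
Qed.

(* Truncating at [J] leaves the last summand as boundary term; it vanishes once [nu < J]
   is a natural number. *)
Lemma hyp_sum_recurrence (J : nat) (nu x b xi : R) : 0 < b -> 0 < xi ->
  (xi - 1) * x * hyp_sum (- nu) (- x) b ((xi - 1) / xi) J =
  xi * (nu + b) * hyp_sum (- (nu + 1)) (- x) b ((xi - 1) / xi) J
  - (nu + xi * (nu + b)) * hyp_sum (- nu) (- x) b ((xi - 1) / xi) J
  + nu * hyp_sum (- (nu - 1)) (- x) b ((xi - 1) / xi) J
  - (xi - 1) * (poch (- nu) J * poch (- x) (S J) / (poch b J * INR (fact J)) * ((xi - 1) / xi) ^ J).
Proof.
  intros Hb Hxi. set (c := (xi - 1) / xi).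
  assert (Hc : xi - 1 = xi * c) by (unfold c; field; lra).
  induction J as [|J IH].
  - rewrite !hyp_sum_0. simpl. field.
  - rewrite !hyp_sum_S.
    assert (E1 : poch (- (nu + 1)) (S J) = - (nu + 1) * poch (- nu) J).
    { rewrite <- poch_shift. do 2 f_equal. ring. }
    (* The factor [nu] is kept on the left because it cannot be divided out: [nu] = 0 is the case of
       degree 0. *)
    assert (E2 : nu * poch (- (nu - 1)) (S J) =
       - (poch (- nu) J * (- nu + INR J) * (- nu + (INR J + 1)))).
    { replace (- (nu - 1)) with (- nu + 1) by ring.
      replace (nu * poch (- nu + 1) (S J)) with (- (- nu * poch (- nu + 1) (S J))) by ring.
      rewrite poch_shift. change (poch (- nu) (S (S J))) with (poch (- nu) J * (- nu + INR J) * (- nu + INR (S J))).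
      now rewrite S_INR. }
    set (K := poch (- x) (S J) / (poch b (S J) * INR (fact (S J))) * c ^ S J).
    assert (E3 : forall a, poch a (S J) * poch (- x) (S J) / (poch b (S J) * INR (fact (S J))) * c ^ S J
      = poch a (S J) * K) by (intros a; unfold K, Rdiv; ring).
    assert (E4 : poch (- x) (S J) / (poch b J * INR (fact J)) * c ^ J * c = K * (b + INR J) * (INR J + 1)).
    { unfold K. change (poch b (S J)) with (poch b J * (b + INR J)).
      change (fact (S J)) with (S J * fact J)%nat. rewrite mult_INR, S_INR.
      pose proof (poch_pos b J Hb). pose proof (INR_fact_lt_0 J). pose proof (pos_INR J).
      simpl pow. field. lra. }
    assert (E5 : poch (- x) (S (S J)) = poch (- x) (S J) * (- x + (INR J + 1))).
    { rewrite <- S_INR. reflexivity. }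
    rewrite !E3, E1.
    (* With xi - 1 = xi c, the boundary term of level J acquires the power c^(J+1) and becomes a
       multiple of [K]. All new terms are then multiples of [poch (- nu) J * K], and a polynomial
       identity remains. *)
    replace ((xi - 1) * (poch (- nu) J * poch (- x) (S J) / (poch b J * INR (fact J)) * c ^ J))
      with (xi * poch (- nu) J * (poch (- x) (S J) / (poch b J * INR (fact J)) * c ^ J * c)) in IH
      by (rewrite Hc; unfold Rdiv; ring).
    rewrite E4 in IH.
    replace (poch (- nu) (S J) * poch (- x) (S (S J)) / (poch b (S J) * INR (fact (S J))) * c ^ S J)
      with (poch (- nu) J * (- nu + INR J) * (- x + (INR J + 1)) * K)
      by (rewrite E5; change (poch (- nu) (S J)) with (poch (- nu) J * (- nu + INR J)); unfold K, Rdiv; ring).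
    replace (poch (- nu) (S J)) with (poch (- nu) J * (- nu + INR J)) by reflexivity.
    rewrite !Rmult_plus_distr_l, IH.
    replace (nu * (poch (- (nu - 1)) (S J) * K)) with (nu * poch (- (nu - 1)) (S J) * K) by ring.
    rewrite E2. clear. ring.
Qed.

Lemma meixner_hyp_sum (n J : nat) (x b xi : R) :
  (n <= J)%nat -> 0 < b -> 0 < xi < 1 ->
  meixner n x b xi = hyp_sum (- INR n) (- x) b ((xi - 1) / xi) J.
Proof.
  intros HJ Hb Hxi. apply hyp2F1_terminating; auto.
  apply Rlt_trans with 0; [|lra].
  replace ((xi - 1) / xi) with (- ((1 - xi) / xi)) by (field; lra).
  assert (0 < (1 - xi) / xi) by (apply Rdiv_lt_0_compat; lra). lra.
Qed.

(** Truncation at [S n] is exact for all three degrees, and the boundary term contains (-n)_(n+1) =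
    0. For n = 0 the value at [pred n] is multiplied by 0. *)
Lemma meixner_recurrence (n : nat) (x b xi : R) : 0 < b -> 0 < xi < 1 ->
  (xi - 1) * x * meixner n x b xi =
  xi * (INR n + b) * meixner (S n) x b xi
  - (INR n + xi * (INR n + b)) * meixner n x b xi
  + INR n * meixner (pred n) x b xi.
Proof.
  intros Hb Hxi.
  rewrite !(meixner_hyp_sum _ (S n)) by (auto; lia).
  rewrite hyp_sum_recurrence, S_INR by lra.
  rewrite poch_opp_INR by lia.
  destruct n as [|n].
  - simpl pred. simpl INR. unfold Rdiv; ring.
  - simpl pred. replace (INR (S n) - 1) with (INR n) by (rewrite S_INR; ring).
    unfold Rdiv; ring.
Qed.

Lemma meixner_0 (x b xi : R) : 0 < b -> 0 < xi < 1 -> meixner 0 x b xi = 1.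
Proof. intros Hb Hxi. rewrite (meixner_hyp_sum 0 0) by auto. apply hyp_sum_0. Qed.

(** Truncated at the common length n + k, both sides are the same sum with its upper parameters
    exchanged. *)
Lemma meixner_self_dual (n k : nat) (b xi : R) : 0 < b -> 0 < xi < 1 ->
  meixner n (INR k) b xi = meixner k (INR n) b xi.
Proof.
  intros Hb Hxi. rewrite (meixner_hyp_sum n (n + k)), (meixner_hyp_sum k (n + k)) by (auto; lia).
  apply hyp_sum_sym.
Qed.

Lemma meixner_difference_equation (n k : nat) (b xi : R) : 0 < b -> 0 < xi < 1 ->
  (xi - 1) * INR n * meixner n (INR k) b xi =
  xi * (INR k + b) * meixner n (INR (S k)) b xi
  - (INR k + xi * (INR k + b)) * meixner n (INR k) b xi
  + INR k * meixner n (INR (pred k)) b xi.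
Proof.
  intros Hb Hxi. rewrite !(meixner_self_dual n) by auto. now apply meixner_recurrence.
Qed.

(** * The Meixner weight, polynomial growth and orthogonality *)

Lemma meixner_weight_S (alpha xi : R) (k : nat) :
  (INR k + 1) * meixner_weight alpha xi (S k) =
  xi * (INR k + (alpha + 1)) * meixner_weight alpha xi k.
Proof.
  unfold meixner_weight. change (fact (S k)) with (S k * fact k)%nat. rewrite mult_INR, S_INR.
  pose proof (INR_fact_lt_0 k). pose proof (pos_INR k). simpl. field. lra.
Qed.

Lemma meixner_weight_pos (alpha xi : R) (k : nat) : -1 < alpha -> 0 < xi ->
  0 < meixner_weight alpha xi k.
Proof.
  intros Ha Hxi. apply Rdiv_lt_0_compat; [|apply INR_fact_lt_0].
  apply Rmult_lt_0_compat; [apply poch_pos; lra|now apply pow_lt].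
Qed.

(** The base [INR k + 1] is at least 1, so bounds of different degrees can be compared at every k,
    including 0. *)
Definition poly_bounded (u : nat -> R) : Prop :=
  exists (C : R) (d : nat), 0 <= C /\ forall k, Rabs (u k) <= C * (INR k + 1) ^ d.

Lemma poly_bounded_const (c : R) : poly_bounded (fun _ => c).
Proof. exists (Rabs c), 0%nat. split; [apply Rabs_pos|]. intros k. simpl. lra. Qed.

Lemma poly_bounded_INR : poly_bounded INR.
Proof.
  exists 1, 1%nat. split; [lra|]. intros k. pose proof (pos_INR k).
  rewrite Rabs_pos_eq by auto. simpl. lra.
Qed.

Lemma poly_bounded_mult (u v : nat -> R) :
  poly_bounded u -> poly_bounded v -> poly_bounded (fun k => u k * v k).
Proof.
  intros (C1 & d1 & H1 & Hu) (C2 & d2 & H2 & Hv). exists (C1 * C2), (d1 + d2)%nat.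
  split; [now apply Rmult_le_pos|]. intros k. rewrite Rabs_mult, pow_add.
  apply Rle_trans with ((C1 * (INR k + 1) ^ d1) * (C2 * (INR k + 1) ^ d2)); [|right; ring].
  apply Rmult_le_compat; auto using Rabs_pos.
Qed.

Lemma poly_bounded_plus (u v : nat -> R) :
  poly_bounded u -> poly_bounded v -> poly_bounded (fun k => u k + v k).
Proof.
  intros (C1 & d1 & H1 & Hu) (C2 & d2 & H2 & Hv). exists (C1 + C2), (d1 + d2)%nat.
  split; [lra|]. intros k. eapply Rle_trans; [apply Rabs_triang|].
  rewrite Rmult_plus_distr_r. pose proof (pos_INR k). apply Rplus_le_compat.
  - eapply Rle_trans; [apply Hu|]. apply Rmult_le_compat_l; auto. apply Rle_pow; [lra|lia].
  - eapply Rle_trans; [apply Hv|]. apply Rmult_le_compat_l; auto. apply Rle_pow; [lra|lia].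
Qed.

Lemma poly_bounded_ext (u v : nat -> R) :
  (forall k, u k = v k) -> poly_bounded u -> poly_bounded v.
Proof. intros E (C & d & HC & H). exists C, d. split; auto. intros k. now rewrite <- E. Qed.

Lemma poly_bounded_meixner (n : nat) (b xi : R) : 0 < b -> 0 < xi < 1 ->
  poly_bounded (fun k => meixner n (INR k) b xi).
Proof.
  intros Hb Hxi.
  assert (Hp : forall j, poly_bounded (fun k => poch (- INR k) j)).
  { induction j as [|j IH]; simpl; [apply poly_bounded_const|].
    apply (poly_bounded_mult _ _ IH). apply poly_bounded_plus; [|apply poly_bounded_const].
    apply poly_bounded_ext with (fun k => -1 * INR k); [intros; ring|].
    apply poly_bounded_mult; [apply poly_bounded_const|apply poly_bounded_INR]. }
  apply poly_bounded_ext with (fun k => hyp_sum (- INR n) (- INR k) b ((xi - 1) / xi) n).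
  { intros k. symmetry. now apply meixner_hyp_sum. }
  generalize (- INR n) as a. intros a. induction n as [|n IH].
  - apply poly_bounded_ext with (fun _ => 1); [intros; now rewrite hyp_sum_0|apply poly_bounded_const].
  - eapply poly_bounded_ext; [intros k; symmetry; apply hyp_sum_S|].
    apply poly_bounded_plus; auto.
    apply poly_bounded_ext with (fun k =>
      (poch a (S n) / (poch b (S n) * INR (fact (S n))) * ((xi - 1) / xi) ^ S n) * poch (- INR k) (S n)).
    { intros k. unfold Rdiv. ring. }
    apply poly_bounded_mult; [apply poly_bounded_const|apply Hp].
Qed.

(** The ratio of consecutive terms tends to xi < 1, so these are the terms of a convergent
    series. *)
Lemma is_lim_pow_meixner_weight (d : nat) (alpha xi : R) : -1 < alpha -> 0 < xi < 1 ->
  is_lim_seq (fun k => (INR k + 1) ^ d * meixner_weight alpha xi k) 0.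
Proof.
  intros Ha Hxi.
  assert (Hpos : forall k, 0 < (INR k + 1) ^ d * meixner_weight alpha xi k).
  { intros k. pose proof (pos_INR k). apply Rmult_lt_0_compat.
    - apply pow_lt; lra.
    - apply meixner_weight_pos; lra. }
  apply ex_series_lim_0.
  apply ex_series_ext with (fun k => Rabs ((INR k + 1) ^ d * meixner_weight alpha xi k)).
  { intros k. apply Rabs_pos_eq. specialize (Hpos k). lra. }
  apply ex_series_DAlembert with xi; [lra| |].
  { intros k. specialize (Hpos k). lra. }
  apply is_lim_seq_ext with (fun k =>
     ((INR k + 2) / (INR k + 1)) ^ d * (xi * ((INR k + (alpha + 1)) / (INR k + 1)))).
  { intros k. rewrite Rabs_pos_eq by (left; apply Rdiv_lt_0_compat; auto).
    pose proof (pos_INR k). pose proof (meixner_weight_pos alpha xi k).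
    rewrite S_INR. replace (INR k + 1 + 1) with (INR k + 2) by ring.
    unfold Rdiv at 1. rewrite Rpow_mult_distr, pow_inv.
    replace (meixner_weight alpha xi (S k)) with (xi * (INR k + (alpha + 1)) * meixner_weight alpha xi k / (INR k + 1))
      by (rewrite <- meixner_weight_S; field; lra).
    field. repeat split; try lra. apply pow_nonzero; lra. }
  replace (Finite xi) with (Finite (1 ^ d * (xi * 1))) by (f_equal; rewrite pow1; ring).
  apply is_lim_seq_mult'.
  - induction d as [|d IH]; simpl; [apply is_lim_seq_const|].
    apply is_lim_seq_mult'; [apply is_lim_seq_INR_ratio, Rlt_0_1|]. apply IH.
    intros k. pose proof (pos_INR k). apply Rmult_lt_0_compat.
    + apply pow_lt; lra.
    + apply meixner_weight_pos; lra.
  - apply (is_lim_seq_scal_l _ xi 1). apply is_lim_seq_INR_ratio, Rlt_0_1.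
Qed.

Lemma is_lim_poly_bounded_meixner_weight (u : nat -> R) (alpha xi : R) :
  -1 < alpha -> 0 < xi < 1 -> poly_bounded u ->
  is_lim_seq (fun k => u k * meixner_weight alpha xi k) 0.
Proof.
  intros Ha Hxi (C & d & HC & Hu).
  apply is_lim_seq_abs_0.
  apply is_lim_seq_le_le with (fun _ => 0) (fun k => C * ((INR k + 1) ^ d * meixner_weight alpha xi k)).
  - intros k. split; [apply Rabs_pos|]. rewrite Rabs_mult.
    pose proof (meixner_weight_pos alpha xi k).
    rewrite (Rabs_pos_eq (meixner_weight alpha xi k)) by lra.
    rewrite <- Rmult_assoc. apply Rmult_le_compat_r; [lra|auto].
  - apply is_lim_seq_const.
  - replace (Finite 0) with (Finite (C * 0)) by (f_equal; ring).
    apply (is_lim_seq_scal_l _ C 0). now apply is_lim_pow_meixner_weight.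
Qed.

(* Discrete Green formula: the difference operator is symmetric for the weight,
   up to a Wronskian at the end point. *)
Lemma meixner_green (n m K : nat) (alpha xi : R) : -1 < alpha -> 0 < xi < 1 ->
  let M i k := meixner i (INR k) (alpha + 1) xi in
  (INR n - INR m) * (xi - 1) * sum_n (fun k => M n k * M m k * meixner_weight alpha xi k) K =
  xi * (INR K + (alpha + 1)) * meixner_weight alpha xi K * (M n (S K) * M m K - M n K * M m (S K)).
Proof.
  intros Ha Hxi M. assert (Hb : 0 < alpha + 1) by lra.
  assert (HM : forall i k, (xi - 1) * INR i * M i k =
    xi * (INR k + (alpha + 1)) * M i (S k) - (INR k + xi * (INR k + (alpha + 1))) * M i k
    + INR k * M i (pred k)) by (intros i k; exact (meixner_difference_equation i k (alpha + 1) xi Hb Hxi)).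
  assert (Hterm : forall k, (INR n - INR m) * (xi - 1) * (M n k * M m k) =
    (xi - 1) * INR n * M n k * M m k - (xi - 1) * INR m * M m k * M n k) by (intros; ring).
  clearbody M.
  (* There is no boundary term at the lower end, because the [pred] term carries [INR 0]. In the
     inductive step, [meixner_weight_S] matches (K+1) f(K+1) with the coefficient of the previous
     Wronskian, which cancels. *)
  induction K as [|K IH].
  - rewrite sum_O. rewrite <- Rmult_assoc, Hterm, !HM. simpl. ring.
  - rewrite sum_n_Sn_R. rewrite Rmult_plus_distr_l, IH.
    rewrite <- (Rmult_assoc _ (M n (S K) * M m (S K))), Hterm, !HM, <- (meixner_weight_S alpha xi K).
    simpl pred. rewrite S_INR. ring.
Qed.

(** Green's formula expresses the partial sum as a sequence of polynomial growth times the weight at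
    the end point, and such a product tends to 0. *)
Lemma meixner_orthogonal (n m : nat) (alpha xi : R) : -1 < alpha -> 0 < xi < 1 -> n <> m ->
  is_lim_seq (sum_n (fun k => meixner n (INR k) (alpha + 1) xi * meixner m (INR k) (alpha + 1) xi *
    meixner_weight alpha xi k)) 0.
Proof.
  intros Ha Hxi Hnm.
  assert (Hne : (INR n - INR m) * (xi - 1) <> 0).
  { apply Rmult_integral_contrapositive_currified; [|lra].
    intros H. apply Hnm, INR_eq. lra. }
  set (M i k := meixner i (INR k) (alpha + 1) xi).
  apply is_lim_seq_ext with (fun K =>
    (/ ((INR n - INR m) * (xi - 1)) * (xi * (INR K + (alpha + 1)) * (M n (S K) * M m K - M n K * M m (S K))))
      * meixner_weight alpha xi K).
  { intros K. apply Rmult_eq_reg_l with ((INR n - INR m) * (xi - 1)); auto.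
    rewrite (meixner_green n m K alpha xi Ha Hxi). fold (M n K) (M n (S K)) (M m K) (M m (S K)).
    field. split.
    - lra.
    - intros H. apply Hne. rewrite H. ring. }
  apply is_lim_poly_bounded_meixner_weight; auto.
  assert (Hpb : forall i, poly_bounded (fun k => M i k)).
  { intros i. refine (poly_bounded_meixner i (alpha + 1) xi _ Hxi). lra. }
  assert (HpbS : forall i, poly_bounded (fun k => M i (S k))).
  (* The factor 2^d comes from k + 2 <= 2 (k + 1). *)
  { intros i. destruct (Hpb i) as (C & d & HC & H). exists (C * 2 ^ d), d. split.
    - apply Rmult_le_pos; auto. apply pow_le; lra.
    - intros k. eapply Rle_trans; [apply H|]. rewrite Rmult_assoc, <- Rpow_mult_distr.
      apply Rmult_le_compat_l; auto. rewrite S_INR. pose proof (pos_INR k).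
      apply pow_incr. lra. }
  apply poly_bounded_mult; [apply poly_bounded_const|].
  apply poly_bounded_mult.
  - apply poly_bounded_mult; [apply poly_bounded_const|].
    apply poly_bounded_plus; [apply poly_bounded_INR|apply poly_bounded_const].
  - apply poly_bounded_ext with (fun k => M n (S k) * M m k + -1 * (M n k * M m (S k))).
    { intros; ring. }
    apply poly_bounded_plus; [|apply poly_bounded_mult; [apply poly_bounded_const|]];
      apply poly_bounded_mult; auto.
Qed.

(** * Norms of the Meixner polynomials and the Christoffel-Darboux formula *)

Lemma CV_radius_poch (b : R) : 0 < b -> CV_radius (fun k => poch b k / INR (fact k)) = 1.
Proof.
  intros Hb. replace (Finite 1) with (Finite (/ 1)) by (f_equal; field).
  apply CV_radius_finite_DAlembert.
  - intros n. apply Rgt_not_eq, Rdiv_lt_0_compat; [now apply poch_pos|apply INR_fact_lt_0].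
  - lra.
  - apply is_lim_seq_ext with (fun n => (INR n + b) / (INR n + 1)).
    + intros n. change (fact (S n)) with (S n * fact n)%nat. rewrite mult_INR, S_INR.
      pose proof (poch_pos b n Hb). pose proof (INR_fact_lt_0 n). pose proof (pos_INR n).
      replace (poch b (S n) / ((INR n + 1) * INR (fact n)) / (poch b n / INR (fact n)))
        with ((INR n + b) / (INR n + 1)) by (simpl; field; lra).
      rewrite Rabs_pos_eq; auto. apply Rmult_le_pos; [lra|]. left; apply Rinv_0_lt_compat; lra.
    + apply is_lim_seq_INR_ratio, Rlt_0_1.
Qed.

(* The generating function [g] satisfies [(1 - x) g' = b g]. *)
Lemma is_series_negative_binomial (b x : R) : 0 < b -> 0 < x < 1 ->
  is_series (fun k => poch b k / INR (fact k) * x ^ k) (Rpower (1 - x) (- b)).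
Proof.
  intros Hb Hx. set (a := fun k => poch b k / INR (fact k)).
  assert (HR : CV_radius a = 1) by now apply CV_radius_poch.
  assert (Hd : forall y, 0 <= y < 1 ->
    (1 - y) * PSeries (PS_derive a) y = b * PSeries a y).
  { intros y Hy.
    assert (Hcv : Rbar_lt (Rabs y) (CV_radius a)) by (rewrite HR; simpl; rewrite Rabs_pos_eq; lra).
    assert (Hcv' : Rbar_lt (Rabs y) (CV_radius (PS_derive a))) by (rewrite CV_radius_derive; auto).
    assert (H1 : is_pseries (PS_derive a) y (PSeries (PS_derive a) y)).
    { now apply PSeries_correct, CV_disk_correct, CV_disk_inside. }
    assert (H2 : is_pseries a y (PSeries a y)) by now apply PSeries_correct, CV_disk_correct, CV_disk_inside.
    pose proof (is_pseries_incr_1 _ _ _ H1) as H3.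
    pose proof (is_pseries_minus _ _ _ _ _ H1 H3) as H4.
    pose proof (is_pseries_scal b _ y _ (Rmult_comm _ _) H2) as H5.
    apply is_pseries_unique in H4. apply is_pseries_unique in H5.
    transitivity (PSeries (PS_minus (PS_derive a) (PS_incr_1 (PS_derive a))) y).
    { rewrite H4. set (p := PSeries (PS_derive a) y). change ((1 - y) * p = p + - (y * p)). ring. }
    transitivity (PSeries (PS_scal b a) y); [|exact H5].
    apply PSeries_ext. intros n. unfold PS_minus, PS_plus, PS_opp, PS_incr_1, PS_derive, PS_scal.
    unfold plus, opp, scal; simpl; unfold mult; simpl.
    assert (Hs : forall n, INR (S n) * a (S n) = (b + INR n) * a n).
    { intros i. unfold a. change (fact (S i)) with (S i * fact i)%nat. rewrite mult_INR.
      pose proof (INR_fact_lt_0 i). rewrite S_INR. pose proof (pos_INR i). simpl. field. lra. }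
    change (INR (S n) * a (S n) + - (match n with 0%nat => 0 | S n0 => INR (S n0) * a (S n0) end) = b * a n).
    destruct n as [|n]; rewrite Hs; cbv iota beta; [simpl|]; ring. }
  (* [H] is g(y) (1 - y)^b. The differential equation makes its derivative vanish, so it keeps its
     value 1 at 0. *)
  set (H y := PSeries a y * exp (b * ln (1 - y))).
  assert (HH : forall y, 0 <= y < 1 -> is_derive H y 0).
  { intros y Hy.
    assert (Hcv : Rbar_lt (Rabs y) (CV_radius a)) by (rewrite HR; simpl; rewrite Rabs_pos_eq; lra).
    assert (D1 := is_derive_PSeries a y Hcv).
    assert (D2 : is_derive (fun y => exp (b * ln (1 - y))) y (b * (- / (1 - y)) * exp (b * ln (1 - y)))).
    { auto_derive; [lra|]. unfold Rminus. field. lra. }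
    pose proof (is_derive_mult _ _ _ _ _ D1 D2 Rmult_comm) as D3.
    replace 0 with (plus (mult (PSeries (PS_derive a) y) (exp (b * ln (1 - y))))
      (mult (PSeries a y) (b * - / (1 - y) * exp (b * ln (1 - y))))); [exact D3|].
    unfold plus, mult; simpl.
    apply Rmult_eq_reg_l with (1 - y); [|lra].
    transitivity (((1 - y) * PSeries (PS_derive a) y - b * PSeries a y) * exp (b * ln (1 - y))).
    - field. lra.
    - rewrite Hd by auto. ring. }
  assert (Hconst : H x = H 0).
  { destruct (MVT_gen H 0 x (fun _ => 0)) as [c [_ Hc]].
    - intros y Hy. rewrite Rmin_left, Rmax_right in Hy by lra. apply HH. lra.
    - intros y Hy. rewrite Rmin_left, Rmax_right in Hy by lra.
      apply continuity_pt_filterlim. apply (ex_derive_continuous H). exists 0. apply HH. lra.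
    - lra. }
  assert (Ha : PSeries a x = Rpower (1 - x) (- b)).
  { unfold H in Hconst. rewrite PSeries_0, Rminus_0_r, ln_1, Rmult_0_r, exp_0 in Hconst.
    unfold a at 2 in Hconst. simpl in Hconst. unfold Rpower.
    replace (- b * ln (1 - x)) with (- (b * ln (1 - x))) by ring. rewrite exp_Ropp.
    pose proof (exp_pos (b * ln (1 - x))). apply Rmult_eq_reg_r with (exp (b * ln (1 - x))); [|lra].
    rewrite Hconst. field. lra. }
  rewrite <- Ha.
  assert (Hcv : Rbar_lt (Rabs x) (CV_radius a)) by (rewrite HR; simpl; rewrite Rabs_pos_eq; lra).
  apply (proj1 (is_pseries_R a x (PSeries a x))). now apply PSeries_correct, CV_disk_correct, CV_disk_inside.
Qed.

Definition meixner_norm_value (alpha xi : R) (n : nat) : R :=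
  INR (fact n) / (xi ^ n * Rpower (1 - xi) (alpha + 1) * poch (alpha + 1) n).

(* Pairing the recurrence for [M_n] with [M_(n+1)] and the one for [M_(n+1)] with [M_n] gives
   [xi (n + beta) h_(n+1) = (n + 1) h_n]. *)
Lemma is_series_meixner_norm (n : nat) (alpha xi : R) : -1 < alpha -> 0 < xi < 1 ->
  is_lim_seq (sum_n (fun k => meixner n (INR k) (alpha + 1) xi * meixner n (INR k) (alpha + 1) xi *
    meixner_weight alpha xi k)) (meixner_norm_value alpha xi n).
Proof.
  intros Ha Hxi. induction n as [|n IH].
  - replace (meixner_norm_value alpha xi 0) with (Rpower (1 - xi) (- (alpha + 1))).
    2:{ rewrite Rpower_Ropp. unfold meixner_norm_value. simpl.
        assert (0 < Rpower (1 - xi) (alpha + 1)) by apply exp_pos. field. lra. }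
    apply is_lim_seq_ext with (sum_n (fun k => poch (alpha + 1) k / INR (fact k) * xi ^ k)).
    { intros K. apply sum_n_ext. intros k. rewrite !meixner_0 by lra. unfold meixner_weight, Rdiv. match goal with |- ?u = ?v => change (@eq R u v) end. ring. }
    apply is_series_negative_binomial; lra.
  - assert (Hb : 0 < alpha + 1) by lra.
    set (M i k := meixner i (INR k) (alpha + 1) xi).
    set (S2 i j := sum_n (fun k => M i k * M j k * meixner_weight alpha xi k)).
    assert (Hrec : forall i k, (xi - 1) * INR k * M i k =
      xi * (INR i + (alpha + 1)) * M (S i) k - (INR i + xi * (INR i + (alpha + 1))) * M i k
      + INR i * M (pred i) k) by (intros i k; exact (meixner_recurrence i _ (alpha + 1) xi Hb Hxi)).
    (* The relation is proved for partial sums, so that limits can be taken term by term. All sums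
       on the right except [S2 n n] are off the diagonal, even for n = 0, where [pred n] = 0 differs
       from [S n] = 1. *)
    assert (E : forall K, xi * (INR n + (alpha + 1)) * S2 (S n) (S n) K =
       (INR n + 1) * S2 n n K + xi * (INR n + 1 + (alpha + 1)) * S2 (S (S n)) n K
       + (INR n + xi * (INR n + (alpha + 1)) - (INR n + 1 + xi * (INR n + 1 + (alpha + 1)))) * S2 n (S n) K
       - INR n * S2 (pred n) (S n) K).
    { assert (Ek : forall k, xi * (INR n + (alpha + 1)) * (M (S n) k * M (S n) k * meixner_weight alpha xi k) =
       (INR n + 1) * (M n k * M n k * meixner_weight alpha xi k)
       + xi * (INR n + 1 + (alpha + 1)) * (M (S (S n)) k * M n k * meixner_weight alpha xi k)
       + (INR n + xi * (INR n + (alpha + 1)) - (INR n + 1 + xi * (INR n + 1 + (alpha + 1)))) *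
         (M n k * M (S n) k * meixner_weight alpha xi k)
       - INR n * (M (pred n) k * M (S n) k * meixner_weight alpha xi k)).
      { intros k. pose proof (Hrec n k) as R1. pose proof (Hrec (S n) k) as R2. simpl pred in R2.
        rewrite S_INR in R2.
        apply (f_equal (fun t => t * M (S n) k)) in R1. apply (f_equal (fun t => t * M n k)) in R2.
        apply (f_equal (fun t => t * meixner_weight alpha xi k)) in R1.
        apply (f_equal (fun t => t * meixner_weight alpha xi k)) in R2. lra. }
      intros K. unfold S2. induction K as [|K IHK].
      - rewrite !sum_O. apply Ek.
      - rewrite !sum_n_Sn_R. specialize (Ek (S K)). lra. }
    assert (Hb' : 0 < INR n + (alpha + 1)) by (pose proof (pos_INR n); lra).
    assert (Ho : forall i j, i <> j -> is_lim_seq (S2 i j) 0).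
    { intros i j Hij. exact (meixner_orthogonal i j alpha xi Ha Hxi Hij). }
    apply is_lim_seq_ext with (fun K => / (xi * (INR n + (alpha + 1))) *
       ((INR n + 1) * S2 n n K + xi * (INR n + 1 + (alpha + 1)) * S2 (S (S n)) n K
       + (INR n + xi * (INR n + (alpha + 1)) - (INR n + 1 + xi * (INR n + 1 + (alpha + 1)))) * S2 n (S n) K
       - INR n * S2 (pred n) (S n) K)).
    { intros K. rewrite <- E. change (/ (xi * (INR n + (alpha + 1))) * (xi * (INR n + (alpha + 1)) * S2 (S n) (S n) K) = S2 (S n) (S n) K).
      field. lra. }
    replace (Finite (meixner_norm_value alpha xi (S n))) with (Finite (/ (xi * (INR n + (alpha + 1))) *
       ((INR n + 1) * meixner_norm_value alpha xi n + xi * (INR n + 1 + (alpha + 1)) * 0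
       + (INR n + xi * (INR n + (alpha + 1)) - (INR n + 1 + xi * (INR n + 1 + (alpha + 1)))) * 0
       - INR n * 0))).
    2:{ f_equal. unfold meixner_norm_value. change (fact (S n)) with (S n * fact n)%nat.
        rewrite mult_INR, S_INR. simpl poch. simpl pow.
        assert (0 < Rpower (1 - xi) (alpha + 1)) by apply exp_pos.
        assert (0 < poch (alpha + 1) n) by (apply poch_pos; lra).
        assert (0 < xi ^ n) by (apply pow_lt; lra).
        field. lra. }
    apply (is_lim_seq_scal_l _ _ (Finite _)).
    apply is_lim_seq_minus'; [apply is_lim_seq_plus'; [apply is_lim_seq_plus'|]|];
      apply (is_lim_seq_scal_l _ _ (Finite _)).
    + exact IH.
    + apply Ho. lia.
    + apply Ho. lia.
    + apply Ho. lia.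
Qed.

Lemma meixner_norm_eq (n : nat) (alpha xi : R) : -1 < alpha -> 0 < xi < 1 ->
  meixner_norm alpha xi n = meixner_norm_value alpha xi n.
Proof.
  intros Ha Hxi. unfold meixner_norm. apply is_series_unique.
  eapply is_series_ext; [|exact (is_series_meixner_norm n alpha xi Ha Hxi)].
  intros k. simpl. ring.
Qed.

(** By the recurrence each term is a combination of two consecutive Wronskians. Since xi (n + beta)
    / h_n = (n + 1) / h_(n+1), with beta = alpha + 1, the sum telescopes. *)
Lemma meixner_christoffel_darboux (m : nat) (alpha xi x y : R) : -1 < alpha -> 0 < xi < 1 ->
  let M n x := meixner n x (alpha + 1) xi in
  (xi - 1) * (x - y) * sum_n (fun n => M n x * M n y / meixner_norm alpha xi n) m =
  Rpower (1 - xi) (alpha + 1) * xi ^ S m * poch (alpha + 1) (S m) / INR (fact m) *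
  (M (S m) x * M m y - M m x * M (S m) y).
Proof.
  intros Ha Hxi M. assert (Hb : 0 < alpha + 1) by lra. set (p := Rpower (1 - xi) (alpha + 1)).
  assert (Hp : 0 < p) by apply exp_pos.
  assert (Hrec : forall i x, (xi - 1) * x * M i x =
      xi * (INR i + (alpha + 1)) * M (S i) x - (INR i + xi * (INR i + (alpha + 1))) * M i x
      + INR i * M (pred i) x) by (intros i k; exact (meixner_recurrence i _ (alpha + 1) xi Hb Hxi)).
  assert (Hterm : forall n, (xi - 1) * (x - y) * (M n x * M n y / meixner_norm alpha xi n) =
     p * xi ^ n * poch (alpha + 1) n / INR (fact n) *
     (xi * (INR n + (alpha + 1)) * (M (S n) x * M n y - M n x * M (S n) y)
      - INR n * (M n x * M (pred n) y - M (pred n) x * M n y))).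
  { intros n. rewrite meixner_norm_eq by auto. unfold meixner_norm_value. fold p.
    assert (0 < poch (alpha + 1) n) by (apply poch_pos; lra).
    assert (0 < xi ^ n) by (apply pow_lt; lra). pose proof (INR_fact_lt_0 n).
    transitivity (p * xi ^ n * poch (alpha + 1) n / INR (fact n) *
      (((xi - 1) * x * M n x) * M n y - ((xi - 1) * y * M n y) * M n x)).
    - field. lra.
    - rewrite !Hrec. unfold Rdiv. ring. }
  clearbody M.
  induction m as [|m IH].
  - rewrite sum_O, Hterm. simpl. field.
  - rewrite sum_n_Sn_R. rewrite Rmult_plus_distr_l, IH, Hterm.
    simpl pred. change (poch (alpha + 1) (S (S m))) with (poch (alpha + 1) (S m) * (alpha + 1 + INR (S m))).
    change (fact (S m)) with (S m * fact m)%nat. rewrite mult_INR.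
    pose proof (INR_fact_lt_0 m). rewrite S_INR. pose proof (pos_INR m).
    simpl pow. fold p. field. lra.
Qed.

(** * Reversal of terminating hypergeometric sums *)

Lemma poch_add (a : R) (m n : nat) : poch a (m + n) = poch a m * poch (a + INR m) n.
Proof.
  induction n as [|n IH].
  - rewrite Nat.add_0_r. simpl. ring.
  - rewrite Nat.add_succ_r. simpl. rewrite IH, plus_INR. ring.
Qed.

Lemma poch_reflect (y : R) (i : nat) : poch (- (y + INR i)) i = (-1) ^ i * poch (y + 1) i.
Proof.
  induction i as [|i IH]; [simpl; ring|].
  rewrite <- poch_shift, S_INR.
  replace (- (y + (INR i + 1)) + 1) with (- (y + INR i)) by ring. rewrite IH. simpl. ring.
Qed.

Lemma sum_n_rev (f : nat -> R) (n : nat) : sum_n f n = sum_n (fun j => f (n - j)%nat) n.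
Proof.
  revert f. induction n as [|n IH]; intros f; [now rewrite !sum_O|].
  transitivity (f 0%nat + sum_n (fun j => f (S j)) n).
  { unfold sum_n. rewrite sum_Sn_m by lia. now rewrite <- sum_n_m_S. }
  rewrite IH, sum_n_Sn_R, Nat.sub_diag. rewrite Rplus_comm. f_equal.
  apply sum_n_ext_loc. intros j Hj. f_equal. lia.
Qed.

(** For i + j = n the term i on the left equals the term j on the right: w^n w^(-i) = w^j inverts
    the argument, and [poch_reflect] turns each upper symbol into a rising one. The two reflections
    on either side produce a squared sign. *)
Lemma hyp_sum_reverse (n : nat) (u b w : R) : 0 < b -> -1 < u -> w <> 0 ->
  poch b n * w ^ n * hyp_sum (- INR n) (- (u + INR n)) b (/ w) n =
  poch (u + 1) n * hyp_sum (- (INR n + b - 1)) (- INR n) (u + 1) w n.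
Proof.
  intros Hb Hu Hw. unfold hyp_sum. rewrite sum_n_rev.
  rewrite <- !(sum_n_mult_l (K := R_Ring)).
  apply sum_n_ext_loc. intros j Hj.
  remember (n - j)%nat as i eqn:Ei. assert (n = i + j)%nat by lia. subst n. clear Ei Hj.
  unfold mult; simpl. rewrite !plus_INR.
  replace (- (INR i + INR j)) with (- (INR j + INR i)) at 1 by ring.
  rewrite poch_reflect.
  replace (- (u + (INR i + INR j))) with (- (u + INR j + INR i)) by ring.
  rewrite poch_reflect.
  replace (- (INR i + INR j + b - 1)) with (- (INR i + b - 1 + INR j)) by ring.
  rewrite !poch_reflect, poch_add, pow_add, pow_inv.
  rewrite (Nat.add_comm i j), (poch_add (u + 1)).
  replace (INR i + b - 1 + 1) with (b + INR i) by ring.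
  replace (u + INR j + 1) with (u + 1 + INR j) by ring.
  (* Both sides are (i + j)!. *)
  assert (F : INR (fact i) * poch (INR i + 1) j = INR (fact j) * poch (INR j + 1) i).
  { rewrite <- !poch_1, !(Rplus_comm _ 1), <- !poch_add. f_equal. lia. }
  pose proof (INR_fact_lt_0 i). pose proof (INR_fact_lt_0 j).
  pose proof (poch_pos b i Hb). pose proof (poch_pos (u + 1) j ltac:(lra)).
  assert (w ^ i <> 0) by (now apply pow_nonzero).
  assert (Hs : forall k, (-1) ^ k * (-1) ^ k = 1).
  { intros k. rewrite <- Rpow_mult_distr. replace (-1 * -1) with 1 by ring. apply pow1. }
  transitivity (poch (b + INR i) j * w ^ j * poch (u + 1 + INR j) i * (poch (INR j + 1) i / INR (fact i)) *
     ((-1) ^ i * (-1) ^ i)); [field; lra|].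
  transitivity (poch (b + INR i) j * w ^ j * poch (u + 1 + INR j) i * (poch (INR i + 1) j / INR (fact j)) *
     ((-1) ^ j * (-1) ^ j)); [|field; lra].
  rewrite !Hs. do 2 f_equal.
  apply Rmult_eq_reg_l with (INR (fact i) * INR (fact j)); [|nra].
  transitivity (INR (fact j) * poch (INR j + 1) i); [field; lra|].
  rewrite <- F. field. lra.
Qed.

(** * The hypergeometric kernel *)

Lemma psi_plus_pos (z z' xi u : R) : 0 < z -> 0 < z' -> 0 < xi < 1 -> -1 < u ->
  0 < psi_plus z z' xi u.
Proof.
  intros Hz Hz' Hxi Hu. unfold psi_plus.
  repeat apply Rmult_lt_0_compat; try apply exp_pos; try (apply Gamma_pos; lra).
  - apply sqrt_lt_R0. now apply Rmult_lt_0_compat.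
  - apply Rinv_0_lt_compat. repeat apply Rmult_lt_0_compat; apply Gamma_pos; lra.
Qed.

Lemma ex_derive_psi_plus (z z' xi u : R) : 0 < z -> 0 < z' -> -1 < u ->
  ex_derive (psi_plus z z' xi) u.
Proof.
  intros Hz Hz' Hu. unfold psi_plus, Rpower.
  assert (HG : forall s, 0 < u + s -> ex_derive (fun v => Gamma (v + s)) u).
  { intros s Hs. apply (ex_derive_comp Gamma (fun v => v + s)).
    - now apply ex_derive_Gamma.
    - auto_derive. exact I. }
  apply (ex_derive_mult (fun v => sqrt (z * z') * exp ((v + 1 / 2) * ln xi) * exp ((z + z') * ln (1 - xi)))).
  { auto_derive. exact I. }
  assert (H1 : ex_derive (fun v => Gamma (v + 1)) u) by (apply HG; lra).
  assert (Hp1 := Gamma_pos (1 + z) ltac:(lra)). assert (Hp2 := Gamma_pos (1 + z') ltac:(lra)).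
  assert (Hp3 := Gamma_pos (u + 1) ltac:(lra)).
  apply (ex_derive_div (fun v => Gamma (v + 1 + z) * Gamma (v + 1 + z'))
    (fun v => Gamma (1 + z) * Gamma (1 + z') * Gamma (v + 1) * Gamma (v + 1))).
  - apply (ex_derive_mult (fun v => Gamma (v + 1 + z)) (fun v => Gamma (v + 1 + z'))).
    + apply ex_derive_ext with (fun v => Gamma (v + (1 + z))).
      * intros v. now rewrite Rplus_assoc.
      * apply HG; lra.
    + apply ex_derive_ext with (fun v => Gamma (v + (1 + z'))).
      * intros v. now rewrite Rplus_assoc.
      * apply HG; lra.
  - apply (ex_derive_mult (fun v => Gamma (1 + z) * Gamma (1 + z') * Gamma (v + 1)) (fun v => Gamma (v + 1))); auto.
    apply (ex_derive_mult (fun _ => Gamma (1 + z) * Gamma (1 + z')) (fun v => Gamma (v + 1))); auto.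
    apply ex_derive_const.
  - apply Rgt_not_eq. repeat apply Rmult_lt_0_compat; auto.
Qed.

Lemma ex_derive_poch (f : R -> R) (u : R) (n : nat) :
  ex_derive f u -> ex_derive (fun v => poch (f v) n) u.
Proof.
  intros Hf. induction n as [|n IH]; [exact (ex_derive_const 1 u)|].
  apply (ex_derive_mult (fun v => poch (f v) n) (fun v => f v + INR n)); auto.
  apply (ex_derive_plus f (fun _ => INR n)); auto. apply ex_derive_const.
Qed.

Lemma ex_derive_meixner (n : nat) (x b xi : R) : 0 < b -> 0 < xi < 1 ->
  ex_derive (fun y => meixner n y b xi) x.
Proof.
  intros Hb Hxi.
  apply ex_derive_ext with (fun y => hyp_sum (- INR n) (- y) b ((xi - 1) / xi) n).
  { intros y. symmetry. now apply meixner_hyp_sum. }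
  unfold hyp_sum. apply (ex_derive_sum_n (fun j y =>
    poch (- INR n) j * poch (- y) j / (poch b j * INR (fact j)) * ((xi - 1) / xi) ^ j)).
  intros j _.
  apply ex_derive_ext with (fun y =>
    (poch (- INR n) j / (poch b j * INR (fact j)) * ((xi - 1) / xi) ^ j) * poch (- y) j).
  { intros y. unfold Rdiv. match goal with |- ?u = ?v => change (@eq R u v) end. ring. }
  apply ex_derive_scal. apply (ex_derive_poch Ropp). auto_derive. exact I.
Qed.

(* The factor [s] contributes nothing: the terms in [s'] cancel, and the derivative of
   [(u - x) r u] at [x] only needs continuity of [r]. *)
Lemma Derive_wronskian_diagonal (P Q s p q r : R -> R) (x : R) :
  locally x (fun u => P u = s u * p u) -> locally x (fun u => Q u = s u * q u) ->
  ex_derive s x -> ex_derive p x -> ex_derive q x -> continuous r x ->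
  locally x (fun u => p u * q x - q u * p x = (u - x) * r u) ->
  Derive P x * Q x - Derive Q x * P x = s x ^ 2 * r x.
Proof.
  intros HP HQ Hs Hp Hq Hr Hw.
  rewrite (locally_singleton _ _ HP), (locally_singleton _ _ HQ).
  rewrite (Derive_ext_loc _ _ _ HP), (Derive_ext_loc _ _ _ HQ).
  rewrite !Derive_mult by auto.
  assert (H : Derive p x * q x - Derive q x * p x = r x).
  { assert (D1 : is_derive (fun u => p u * q x - q u * p x) x (Derive p x * q x - Derive q x * p x)).
    { apply (is_derive_minus (fun u => p u * q x) (fun u => q u * p x));
        apply (is_derive_scal_l (V := R_NormedModule)); now apply Derive_correct. }
    assert (D2 : is_derive (fun u => p u * q x - q u * p x) x (r x)).
    { apply is_derive_ext_loc with (fun u => (u - x) * r u).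
      - apply filter_imp with (2 := Hw). intros u Hu. now rewrite Hu.
      - apply is_derive_Reals. intros eps He.
        destruct (proj1 (filterlim_locally (T := R_UniformSpace) (U := R_UniformSpace)
          (F := locally x) r (r x)) Hr (mkposreal eps He)) as [d Hd].
        exists d. intros h Hh0 Hh.
        replace (((x + h - x) * r (x + h) - (x - x) * r x) / h) with (r (x + h)) by (field; auto).
        apply (Hd (x + h)). unfold ball; simpl; unfold AbsRing_ball, abs, minus, plus, opp; simpl.
        now replace (x + h + - x) with h by ring. }
    apply is_derive_unique in D1. apply is_derive_unique in D2. congruence. }
  rewrite <- H. ring.
Qed.

Lemma psi_plus_INR (N k : nat) (alpha xi : R) : (1 <= N)%nat -> -1 < alpha -> 0 < xi < 1 ->
  psi_plus (INR N + alpha) (INR N) xi (INR k) =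
  sqrt ((INR N + alpha) * INR N) * sqrt xi * xi ^ k * Rpower (1 - xi) (INR N + alpha + INR N) *
  (poch (1 + (INR N + alpha)) k * poch (1 + INR N) k / (INR (fact k) * INR (fact k))).
Proof.
  intros HN Ha Hxi. apply le_INR in HN. simpl in HN. unfold psi_plus.
  rewrite Rpower_plus, Rpower_pow by lra.
  replace (1 / 2) with (/ 2) by lra. rewrite Rpower_sqrt by lra.
  replace (INR k + 1 + (INR N + alpha)) with (1 + (INR N + alpha) + INR k) by ring.
  replace (INR k + 1 + INR N) with (1 + INR N + INR k) by ring.
  rewrite (Rplus_comm (INR k) 1), !(Gamma_plus_INR _ k), Gamma_1, poch_1 by lra.
  assert (Hp1 := Gamma_pos (1 + (INR N + alpha)) ltac:(lra)).
  assert (Hp2 := Gamma_pos (1 + INR N) ltac:(lra)).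
  pose proof (INR_fact_lt_0 k). field. lra.
Qed.

(** One constant in two roles, with N = m + 1: it turns psi_+(k) into f(k + N) (k+1)_N^2, and it is
    the factor of the Christoffel-Darboux sum in the Wronskian of [p_factor] and [q_factor]. As both
    roles call for the same constant, the kernels agree exactly. *)
Definition kernel_gauge (alpha xi : R) (m : nat) : R :=
  sqrt ((INR (S m) + alpha) * INR (S m)) * sqrt xi * poch (alpha + 1) m * INR (fact m) * xi ^ m /
  Rpower (1 - xi) (INR (S m) + alpha + INR (S m)).

Lemma kernel_gauge_pos (m : nat) (alpha xi : R) : -1 < alpha -> 0 < xi < 1 ->
  0 < kernel_gauge alpha xi m.
Proof.
  intros Ha Hxi. apply Rdiv_lt_0_compat; [|apply exp_pos].
  rewrite S_INR. pose proof (pos_INR m).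
  repeat apply Rmult_lt_0_compat; try (apply sqrt_lt_R0; nra).
  - apply poch_pos; lra.
  - apply INR_fact_lt_0.
  - apply pow_lt; lra.
Qed.

Lemma psi_plus_meixner_weight (m k : nat) (alpha xi : R) : -1 < alpha -> 0 < xi < 1 ->
  psi_plus (INR (S m) + alpha) (INR (S m)) xi (INR k) * kernel_gauge alpha xi m =
  meixner_weight alpha xi (k + S m) * poch (INR k + 1) (S m) ^ 2.
Proof.
  intros Ha Hxi. rewrite psi_plus_INR by (auto; lia). unfold kernel_gauge.
  assert (HN : 0 < INR (S m)) by (apply lt_0_INR; lia).
  assert (Hz : 0 < INR (S m) + alpha) by (rewrite S_INR; pose proof (pos_INR m); lra).
  assert (F3 : poch (alpha + 1) (k + S m) =
    poch (alpha + 1) m * (INR (S m) + alpha) * poch (1 + (INR (S m) + alpha)) k).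
  { rewrite (Nat.add_comm k), poch_add.
    change (poch (alpha + 1) (S m)) with (poch (alpha + 1) m * (alpha + 1 + INR m)).
    rewrite !S_INR. f_equal; f_equal; ring. }
  set (z := INR (S m) + alpha) in *. clearbody z.
  assert (Hp : 0 < Rpower (1 - xi) (z + INR (S m))) by apply exp_pos.
  assert (Hs : sqrt (z * INR (S m)) * sqrt (z * INR (S m)) = z * INR (S m))
    by (apply sqrt_sqrt; nra).
  assert (Hx : sqrt xi * sqrt xi = xi) by (apply sqrt_sqrt; lra).
  unfold meixner_weight.
  (* (k + N)! is used in two forms, k! (k+1)_N and N! (N+1)_k: the first rewrites the right side,
     the second absorbs the symbol (1 + N)_k of psi_+. *)
  assert (F : forall i j, INR (fact i) * poch (INR i + 1) j = INR (fact (i + j))).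
  { intros i j. rewrite <- !poch_1, (Rplus_comm _ 1). symmetry. apply poch_add. }
  assert (F1 := F k (S m)). assert (F2 := F (S m) k).
  rewrite (Rplus_comm _ 1), (Nat.add_comm (S m) k) in F2.
  assert (F4 : INR (fact (S m)) = INR (S m) * INR (fact m)) by (rewrite <- mult_INR; reflexivity).
  rewrite F4 in F2.
  pose proof (INR_fact_lt_0 k) as Hk. pose proof (INR_fact_lt_0 m). pose proof (INR_fact_lt_0 (k + S m)).
  replace (poch (INR k + 1) (S m)) with (INR (fact (k + S m)) / INR (fact k)) by (rewrite <- F1; field; lra).
  rewrite F3, pow_add. simpl (xi ^ S m).
  transitivity ((sqrt (z * INR (S m)) * sqrt (z * INR (S m))) * (sqrt xi * sqrt xi) * xi ^ k * xi ^ m *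
    poch (alpha + 1) m * poch (1 + z) k * (INR (fact m) * poch (1 + INR (S m)) k) / (INR (fact k) * INR (fact k))).
  { field. lra. }
  rewrite Hs, Hx.
  transitivity (z * xi * xi ^ k * xi ^ m * poch (alpha + 1) m * poch (1 + z) k *
    (INR (S m) * INR (fact m) * poch (1 + INR (S m)) k) / (INR (fact k) * INR (fact k))).
  { field. lra. }
  rewrite F2. field. lra.
Qed.

(** This is the reversal at w = xi / (xi - 1) and b = alpha + 1: 1/w is exactly the Meixner
    argument, and N + b - 1 = N + alpha. The symmetry first brings the terminating parameter -N to
    the front. *)
Lemma hyp2F1_meixner (N : nat) (alpha xi u : R) : -1 < alpha -> 0 < xi < 1 -> -1 < u ->
  hyp2F1 (- (INR N + alpha)) (- INR N) (u + 1) (xi / (xi - 1)) =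
  poch (alpha + 1) N * (xi / (xi - 1)) ^ N * meixner N (u + INR N) (alpha + 1) xi / poch (u + 1) N.
Proof.
  intros Ha Hxi Hu.
  assert (Hw : xi / (xi - 1) < 0).
  { replace (xi / (xi - 1)) with (- (xi / (1 - xi))) by (field; lra).
    assert (0 < xi / (1 - xi)) by (apply Rdiv_lt_0_compat; lra). lra. }
  rewrite hyp2F1_sym, (hyp2F1_terminating N N), hyp_sum_sym by (auto; lra).
  rewrite (meixner_hyp_sum N N) by (auto; lra).
  pose proof (hyp_sum_reverse N u (alpha + 1) (xi / (xi - 1)) ltac:(lra) Hu ltac:(lra)) as H.
  replace (INR N + (alpha + 1) - 1) with (INR N + alpha) in H by ring.
  replace (/ (xi / (xi - 1))) with ((xi - 1) / xi) in H by (field; lra).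
  rewrite H. field. apply Rgt_not_eq, poch_pos. lra.
Qed.

Definition cd_sum (alpha xi : R) (m : nat) (x y : R) : R :=
  sum_n (fun n => meixner n x (alpha + 1) xi * meixner n y (alpha + 1) xi / meixner_norm alpha xi n) m.

Definition p_factor (alpha xi : R) (m : nat) (u : R) : R :=
  poch (alpha + 1) (S m) * (xi / (xi - 1)) ^ S m * meixner (S m) (u + INR (S m)) (alpha + 1) xi /
  poch (u + 1) (S m).

Definition q_factor (alpha xi : R) (m : nat) (u : R) : R :=
  sqrt ((INR (S m) + alpha) * INR (S m)) * sqrt xi / (1 - xi) *
  (poch (alpha + 1) m * (xi / (xi - 1)) ^ m * meixner m (u + INR (S m)) (alpha + 1) xi /
   poch (u + 1) (S m)).

Lemma P_plus_factor (m : nat) (alpha xi u : R) : -1 < alpha -> 0 < xi < 1 -> -1 < u ->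
  P_plus (INR (S m) + alpha) (INR (S m)) xi u =
  sqrt (psi_plus (INR (S m) + alpha) (INR (S m)) xi u) * p_factor alpha xi m u.
Proof. intros Ha Hxi Hu. unfold P_plus. now rewrite hyp2F1_meixner. Qed.

(** Lowering N to m while raising u to u + 1 leaves the Meixner argument u + N unchanged, and the
    factor 1/(u + 1) completes (u+2)_m to (u+1)_N. Hence [p_factor] and [q_factor] share a
    denominator. *)
Lemma Q_plus_factor (m : nat) (alpha xi u : R) : -1 < alpha -> 0 < xi < 1 -> -1 < u ->
  Q_plus (INR (S m) + alpha) (INR (S m)) xi u =
  sqrt (psi_plus (INR (S m) + alpha) (INR (S m)) xi u) * q_factor alpha xi m u.
Proof.
  intros Ha Hxi Hu. unfold Q_plus, q_factor.
  replace (1 - (INR (S m) + alpha)) with (- (INR m + alpha)) by (rewrite S_INR; ring).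
  replace (1 - INR (S m)) with (- INR m) by (rewrite S_INR; ring).
  replace (u + 2) with (u + 1 + 1) by ring.
  rewrite hyp2F1_meixner, <- poch_shift by lra.
  replace (u + 1 + INR m) with (u + INR (S m)) by (rewrite S_INR; ring).
  pose proof (poch_pos (u + 1 + 1) m ltac:(lra)). field. lra.
Qed.

(* Christoffel-Darboux, with [N = m + 1]. *)
Lemma factor_wronskian (m : nat) (alpha xi u v : R) : -1 < alpha -> 0 < xi < 1 -> -1 < u -> -1 < v ->
  p_factor alpha xi m u * q_factor alpha xi m v - q_factor alpha xi m u * p_factor alpha xi m v =
  (u - v) * (kernel_gauge alpha xi m * cd_sum alpha xi m (u + INR (S m)) (v + INR (S m)) /
    (poch (u + 1) (S m) * poch (v + 1) (S m))).
Proof.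
  intros Ha Hxi Hu Hv.
  pose proof (meixner_christoffel_darboux m alpha xi (u + INR (S m)) (v + INR (S m)) Ha Hxi) as CD.
  cbv zeta beta in CD. fold (cd_sum alpha xi m (u + INR (S m)) (v + INR (S m))) in CD.
  unfold p_factor, q_factor, kernel_gauge.
  assert (ER : Rpower (1 - xi) (INR (S m) + alpha + INR (S m)) =
    Rpower (1 - xi) (alpha + 1) * ((1 - xi) ^ m * (1 - xi) ^ m) * (1 - xi)).
  { replace (INR (S m) + alpha + INR (S m)) with (alpha + 1 + (INR m + INR m) + 1)
      by (rewrite S_INR; ring).
    now rewrite !Rpower_plus, Rpower_1, !Rpower_pow by lra. }
  rewrite ER. clear ER.
  assert (Hp : 0 < Rpower (1 - xi) (alpha + 1)) by apply exp_pos.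
  pose proof (poch_pos (u + 1) (S m) ltac:(lra)) as Hdu.
  pose proof (poch_pos (v + 1) (S m) ltac:(lra)) as Hdv.
  pose proof (poch_pos (alpha + 1) (S m) ltac:(lra)) as Hda.
  pose proof (INR_fact_lt_0 m) as Hfm. pose proof (pow_lt xi m ltac:(lra)) as Hxm.
  pose proof (pow_lt (1 - xi) m ltac:(lra)) as Hym.
  (* The odd power 2m + 1 of the negative number xi / (xi - 1) gives a minus sign, which cancels
     that of the factor xi - 1 in the Christoffel-Darboux formula. *)
  assert (Ew : (xi / (xi - 1)) ^ S m * (xi / (xi - 1)) ^ m =
    - (xi * xi ^ m * xi ^ m) / ((1 - xi) ^ m * (1 - xi) ^ m * (1 - xi))).
  { assert (E : (xi / (xi - 1)) ^ m * (xi / (xi - 1)) ^ m = (xi / (1 - xi)) ^ m * (xi / (1 - xi)) ^ m).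
    { rewrite <- !Rpow_mult_distr. f_equal. field. lra. }
    simpl. rewrite Rmult_assoc, E. unfold Rdiv at 2 3. rewrite Rpow_mult_distr, pow_inv. field. lra. }
  simpl (xi ^ S m) in CD.
  set (S2 := cd_sum _ _ _ _ _) in *.
  set (Mu1 := meixner (S m) (u + INR (S m)) _ _) in *.
  set (Mv1 := meixner (S m) (v + INR (S m)) _ _) in *.
  set (Mu := meixner m (u + INR (S m)) _ _) in *.
  set (Mv := meixner m (v + INR (S m)) _ _) in *.
  set (w1 := (xi / (xi - 1)) ^ S m) in *. set (w := (xi / (xi - 1)) ^ m) in *.
  set (sz := sqrt ((INR (S m) + alpha) * INR (S m))).
  clearbody S2 Mu1 Mv1 Mu Mv w1 w sz.
  replace (u + INR (S m) - (v + INR (S m))) with (u - v) in CD by ring.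
  transitivity (sz * sqrt xi / (1 - xi) * poch (alpha + 1) (S m) * poch (alpha + 1) m * (w1 * w) /
    (poch (u + 1) (S m) * poch (v + 1) (S m)) * (Mu1 * Mv - Mu * Mv1)).
  { field. lra. }
  assert (EW : Mu1 * Mv - Mu * Mv1 = (xi - 1) * (u - v) * S2 * INR (fact m) /
    (Rpower (1 - xi) (alpha + 1) * (xi * xi ^ m) * poch (alpha + 1) (S m))).
  { apply Rmult_eq_reg_l with (Rpower (1 - xi) (alpha + 1) * (xi * xi ^ m) * poch (alpha + 1) (S m) / INR (fact m)).
    - rewrite <- CD. field. lra.
    - apply Rgt_not_eq, Rdiv_lt_0_compat; [|exact Hfm].
      repeat (apply Rmult_lt_0_compat; try assumption). apply Hxi. }
  rewrite EW, Ew. field. lra.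
Qed.

Lemma ex_derive_meixner_shift (n : nat) (a x b xi : R) : 0 < b -> 0 < xi < 1 ->
  ex_derive (fun u => meixner n (u + a) b xi) x.
Proof.
  intros Hb Hxi. apply (ex_derive_comp (fun y => meixner n y b xi) (fun u => u + a)).
  - now apply ex_derive_meixner.
  - auto_derive. exact I.
Qed.

Lemma sqrt_psi_plus_meixner_weight (m k : nat) (alpha xi : R) : -1 < alpha -> 0 < xi < 1 ->
  sqrt (psi_plus (INR (S m) + alpha) (INR (S m)) xi (INR k)) * sqrt (kernel_gauge alpha xi m) /
    poch (INR k + 1) (S m) = sqrt (meixner_weight alpha xi (k + S m)).
Proof.
  intros Ha Hxi. pose proof (pos_INR k). pose proof (pos_INR m).
  pose proof (poch_pos (INR k + 1) (S m) ltac:(lra)) as Hd.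
  pose proof (meixner_weight_pos alpha xi (k + S m) Ha ltac:(lra)).
  rewrite <- sqrt_mult_alt by (left; apply psi_plus_pos; rewrite ?S_INR; lra).
  rewrite (psi_plus_meixner_weight m k alpha xi Ha Hxi).
  rewrite sqrt_mult_alt, sqrt_pow2 by lra. field. lra.
Qed.

Theorem proposition4p1 (N : nat) (alpha xi : R)
  (hN : (1 <= N)%nat) (halpha : -1 < alpha) (hxi0 : 0 < xi) (hxi1 : xi < 1)
  (k l : nat) :
  K_plus_plus (INR N + alpha) (INR N) xi k l =
  meixner_kernel alpha xi N (k + N) (l + N).
Proof.
  destruct N as [|m]; [lia|]. clear hN.
  assert (Hxi : 0 < xi < 1) by lra.
  assert (HN : 0 < INR (S m)) by (apply lt_0_INR; lia).
  assert (Hz : 0 < INR (S m) + alpha) by (rewrite S_INR; pose proof (pos_INR m); lra).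
  pose (s u := sqrt (psi_plus (INR (S m) + alpha) (INR (S m)) xi u)).
  assert (Hkl : forall j, -1 < INR j) by (intros j; pose proof (pos_INR j); lra).
  assert (Hd : forall j, 0 < poch (INR j + 1) (S m))
    by (intros j; apply poch_pos; pose proof (pos_INR j); lra).
  (* This intermediate form has no denominator k - l, so it serves the diagonal and the off-diagonal
     case alike. *)
  transitivity (s (INR k) * s (INR l) *
    (kernel_gauge alpha xi m / (poch (INR k + 1) (S m) * poch (INR l + 1) (S m))) *
    cd_sum alpha xi m (INR k + INR (S m)) (INR l + INR (S m))).
  - pose proof (Hd k) as Hdk. pose proof (Hd l) as Hdl.
    unfold K_plus_plus. cbv zeta. destruct (Nat.eq_dec k l) as [<-|Hne].
    + assert (Hloc : locally (INR k) (fun u => -1 < u)) by (apply (open_gt (-1)), Hkl).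
      assert (Hb : 0 < alpha + 1) by lra.
      assert (Hdd : ex_derive (fun u => poch (u + 1) (S m)) (INR k))
        by (apply ex_derive_poch; auto_derive; exact I).
      (* The quotient [r] is the right side of [factor_wronskian] with its second argument frozen at
         k. It is continuous there because it is a finite sum of polynomials over a nonvanishing
         denominator. *)
      rewrite (Derive_wronskian_diagonal _ _ s (p_factor alpha xi m) (q_factor alpha xi m)
        (fun u => kernel_gauge alpha xi m * cd_sum alpha xi m (u + INR (S m)) (INR k + INR (S m)) /
          (poch (u + 1) (S m) * poch (INR k + 1) (S m))) (INR k)).
      * field. lra.
      * apply filter_imp with (2 := Hloc). intros u Hu. now apply P_plus_factor.
      * apply filter_imp with (2 := Hloc). intros u Hu. now apply Q_plus_factor.
      * apply (ex_derive_comp sqrt (psi_plus (INR (S m) + alpha) (INR (S m)) xi)).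
        -- eexists. apply is_derive_Reals, derivable_pt_lim_sqrt. now apply psi_plus_pos.
        -- now apply ex_derive_psi_plus.
      * apply ex_derive_div; [|auto|lra]. apply ex_derive_scal. now apply ex_derive_meixner_shift.
      * apply ex_derive_scal. apply ex_derive_div; [|auto|lra].
        apply ex_derive_scal. now apply ex_derive_meixner_shift.
      * apply (ex_derive_continuous (K := R_AbsRing) (V := R_NormedModule)).
        apply ex_derive_div; [| |nra].
        -- apply ex_derive_scal.
           apply (ex_derive_sum_n (fun n u => meixner n (u + INR (S m)) (alpha + 1) xi *
             meixner n (INR k + INR (S m)) (alpha + 1) xi / meixner_norm alpha xi n)).
           intros n _. apply ex_derive_mult; [|apply ex_derive_const].
           apply ex_derive_mult; [now apply ex_derive_meixner_shift|apply ex_derive_const].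
        -- apply ex_derive_mult; [auto|apply ex_derive_const].
      * apply filter_imp with (2 := Hloc). intros u Hu. now apply factor_wronskian.
    + assert (Hkl' : INR k - INR l <> 0) by (intros H; apply Hne, INR_eq; lra).
      rewrite !P_plus_factor, !Q_plus_factor by auto.
      fold (s (INR k)) (s (INR l)).
      pose proof (factor_wronskian m alpha xi (INR k) (INR l) halpha Hxi (Hkl k) (Hkl l)) as W.
      transitivity (s (INR k) * s (INR l) * (p_factor alpha xi m (INR k) * q_factor alpha xi m (INR l)
        - q_factor alpha xi m (INR k) * p_factor alpha xi m (INR l)) / (INR k - INR l)).
      { field. auto. }
      rewrite W. field. lra.
  - rewrite <- !plus_INR. unfold meixner_kernel.
    pose proof (meixner_weight_pos alpha xi (k + S m) halpha hxi0).
    rewrite (sum_n_mult_r (K := R_Ring)).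
    change (mult ?a ?b) with (a * b). rewrite Rmult_comm. f_equal.
    rewrite sqrt_mult_alt, <- !sqrt_psi_plus_meixner_weight by lra.
    pose proof (kernel_gauge_pos m alpha xi halpha Hxi).
    (* One square root of the gauge goes to each of the points k and l, where it completes the
       square root of the weight. *)
    rewrite <- (sqrt_sqrt (kernel_gauge alpha xi m)) at 1 by lra.
    fold (s (INR k)) (s (INR l)).
    pose proof (Hd k). pose proof (Hd l). field. lra.
Qed.
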